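(* The two notions of ''LDN-comonad'' and ''star-autonomous comonad'' (both defined in the context) coincide, under the identification of linearly distributive categories with negations and star-autonomous categories. Precisely: (a) Let $\mathcal{C}$ be a linearly distributive category with negations, and let $(G,\delta,\epsilon)$ with $(\phi,\phi_0)$, $(\psi,\psi_0)$, $\nu,\nu'$ be an LDN-comonad on $\mathcal{C}$. Then $(G,\delta,\epsilon)$ with $(\phi,\phi_0)$, $\nu,\nu'$ is a star-autonomous comonad on the star-autonomous category $(\mathcal{C},\star,I,S,S')$ associated with $\mathcal{C}$. (b) Let $\mathcal{C}=(\mathcal{C},\otimes,I,S,S')$ be a star-autonomous category, and let $(G,\delta,\epsilon)$ with $(\phi,\phi_0)$, $\nu,\nu'$ be a star-autonomous comonad on $\mathcal{C}$. Then there are structure maps $(\psi,\psi_0)$ such that $(G,\delta,\epsilon)$ with $(\phi,\phi_0)$, $(\psi,\psi_0)$, $\nu,\nu'$ is an LDN-comonad on the linearly distributive category with negations associated with $\mathcal{C}$.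
   Context: Associativity and unit isomorphisms of monoidal structures are suppressed from the notation (monoidal structures are treated as if strict, though strictness is not essential; in the non-strict case the canonical isomorphisms are inserted). **Linearly distributive categories with negations.** A linearly distributive category has two monoidal structures $(\star,I)$, $(\diamond,J)$ (no symmetry is assumed) and natural transformations $\partial_l:A\star(B\diamond C)\to(A\star B)\diamond C$, $\partial_r:(B\diamond C)\star A\to B\diamond(C\star A)$ satisfying the Cockett–Seely coherence conditions: $\partial_l$ is the canonical identification when $A=I$ or $C=J$; $\partial_r$ is so when $A=I$ or $B=J$; the two evident composites of linear distributions agree for $A\star B\star(C\diamond D)\to(A\star B\star C)\diamond D$, for $A\star(B\diamond C\diamond D)\to(A\star B)\diamond C\diamond D$, for the two mirror-image cases for $\partial_r$, for $A\star(B\diamond C)\star D\to(A\star B)\diamond(C\star D)$, and for $(A\diamond B)\star(C\diamond D)\to A\diamond(B\star C)\diamond D$. Negations are functors $S,S':\mathcal{C}^{\mathrm{op}}\to\mathcal{C}$ with dinatural $e_A:SA\star A\to J$, $e'_A:A\star S'A\to J$, $n_A:I\to A\diamond SA$, $n'_A:I\to S'A\diamond A$ satisfying the four triangle identities: $(1\diamond e_A)\partial_r(n_A\star1)=1_A$, $(e_A\diamond1)\partial_l(1\star n_A)=1_{SA}$, $(e'_A\diamond1)\partial_l(1\star n'_A)=1_A$, $(1\diamond e'_A)\partial_r(n'_A\star1)=1_{S'A}$. **Star-autonomous categories.** A star-autonomous category is a monoidal category $(\mathcal{C},\otimes,I)$ with an adjoint equivalence $S\dashv S':\mathcal{C}^{\mathrm{op}}\to\mathcal{C}$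 (so $S,S'$ are contravariant, with natural isomorphisms $SS'A\cong A\cong S'SA$) and isomorphisms $\mathcal{C}(A\otimes B,SC)\cong\mathcal{C}(A,S(B\otimes C))$ natural in $A,B,C$. By Yoneda the latter determine, and are determined by, morphisms $e_{A,B}:S(A\otimes B)\otimes A\to SB$ and $e'_{B,A}:B\otimes S'(A\otimes B)\to S'A$. **The correspondence.** From a linearly distributive category with negations one obtains a star-autonomous category with $\otimes=\star$, the same $I,S,S'$, mutually inverse isomorphisms $A\to S'SA$, $S'SA\to A$ given by $(1\diamond e_A)\partial_r(n'_{SA}\star1)$ and $(1\diamond e'_{SA})\partial_r(n_A\star1)$ (and analogously for $SS'A\cong A$), and $e_{A,B}=(e_{A\star B}\diamond1)\,\partial_l\,(1\star1\star n_B):S(A\star B)\star A\to(S(A\star B)\star A\star B)\diamond SB\to SB$, $e'_{B,A}=(1\diamond e'_{A\star B})\,\partial_r\,(n'_A\star1\star1):B\star S'(A\star B)\to S'A\diamond(A\star B\star S'(A\star B))\to S'A$. Conversely, from a star-autonomous category one puts $\star=\otimes$, $A\diamond B=S'(SB\otimes SA)\cong S(S'B\otimes S'A)$, $J=SI\cong S'I$, negations $S,S'$. Up to these canonical isomorphisms, $\partial_l$ is $A\otimes S'(SC\otimes SB)\xrightarrow{1\otimes S'(1\otimes e_{A,B})}A\otimes S'(SC\otimes S(A\otimes B)\otimes A)\xrightarrow{e'}S'(SC\otimes S(A\otimes B))$, $\partial_r$ is $S(S'C\otimes S'B)\otimes A\xrightarrow{S(e'_{A,C}\otimes1)\otimes1}S(A\otimes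 S'(C\otimes A)\otimes S'B)\otimes A\xrightarrow{e}S(S'(C\otimes A)\otimes S'B)$, and $e_A=e_{A,I}$, $e'_A=e'_{A,I}$, $n_A=(I\cong SS'I\xrightarrow{Se'_{A,I}}S(A\otimes S'A)\cong A\diamond SA)$, $n'_A=(I\cong S'SI\xrightarrow{S'e_{A,I}}S'(SA\otimes A)\cong S'A\diamond A)$. **Monoidal comonads and lifting.** A comonad $(G,\delta,\epsilon)$ is monoidal with respect to a monoidal structure if $G$ is a (lax) monoidal functor and $\delta:G\to G^2$, $\epsilon:G\to1$ are monoidal natural transformations. ''$S$ may be lifted to $\mathcal{C}^G$ via $\nu$'' means $\nu:S\to GSG$ is natural with $\epsilon_{SGA}\nu_A=S\epsilon_A$ and $\delta_{SGA}\nu_A=G^2S(\delta_A)\,G(\nu_{GA})\,\nu_A$ for all $A$; similarly for $S'$ and $\nu':S'\to GS'G$. **LDN-comonad** (name used here only). On a linearly distributive category with negations $\mathcal{C}$: a comonad $(G,\delta,\epsilon)$, monoidal with respect to $(\star,I)$ via $(\phi,\phi_0)$ and with respect to $(\diamond,J)$ via $(\psi,\psi_0)$, such that for all $G$-coalgebras (with underlying objects) $A,B,C$ $G(\partial_l)\,\phi\,(1_{GA}\star\psi_{B,C})=\psi\,(\phi_{A,B}\diamond1_{GC})\,\partial_l:GA\star(GB\diamond GC)\to G((A\star B)\diamond C)$ and $G(\partial_r)\,\phi\,(\psi_{B,C}\star1_{GA})=\psi\,(1_{GB}\diamond\phi_{C,A})\,\partial_r:(GB\diamond GC)\star GA\to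 G(B\diamond(C\star A))$, together with $\nu,\nu'$ via which $S,S'$ may be lifted to $\mathcal{C}^G$, and such that for every object $A$: $\psi_0\,e_A\,(1\star\epsilon_A)=G(e_{GA})\,\phi\,(\nu_A\star\delta_A):SA\star GA\to GJ$; $G(1\diamond S\epsilon_A)\,G(n_A)\,\phi_0=G(1\diamond S\delta_A)\,\psi\,(1\diamond\nu_{GA})\,n_{GA}:I\to G(A\diamond SGA)$; $\psi_0\,e'_A\,(\epsilon_A\star1)=G(e'_{GA})\,\phi\,(\delta_A\star\nu'_A):GA\star S'A\to GJ$; $G(S'\epsilon_A\diamond1)\,G(n'_A)\,\phi_0=G(S'\delta_A\diamond1)\,\psi\,(\nu'_{GA}\diamond1)\,n'_{GA}:I\to G(S'GA\diamond A)$. **Star-autonomous comonad.** On a star-autonomous category $\mathcal{C}$: a comonad $(G,\delta,\epsilon)$, monoidal with respect to $(\otimes,I)$ via $(\phi,\phi_0)$, together with $\nu,\nu'$ via which $S,S'$ may be lifted to $\mathcal{C}^G$, such that for all $A,B$: (1) $GS(\nu'_A)\circ\nu_{S'GA}:SS'GA\to GSGS'GA\to GSS'A$ equals the canonical isomorphism $SS'GA\cong GA\cong GSS'A$; (2) $GS'(\nu_A)\circ\nu'_{SGA}:S'SGA\to GS'GSGA\to GS'SA$ equals the canonical isomorphism $S'SGA\cong GA\cong GS'SA$; (3) $\nu_B\,e_{A,B}\,(1\otimes\epsilon_A)=G(e_{GA,GB})\,G(S\phi_{A,B}\otimes1)\,\phi\,(\nu_{A\otimes B}\otimes\delta_A):S(A\otimes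 B)\otimes GA\to GSGB$; (4) $\nu'_A\,e'_{B,A}\,(\epsilon_B\otimes1)=G(e'_{GB,GA})\,G(1\otimes S'\phi_{A,B})\,\phi\,(\delta_B\otimes\nu'_{A\otimes B}):GB\otimes S'(A\otimes B)\to GS'GA$. *)

(* Defs.v *)
Set Implicit Arguments.
Unset Strict Implicit.
Unset Printing Implicit Defensive.

Reserved Notation "A ~> B" (at level 70, no associativity).
Reserved Notation "g ∘ f" (at level 50, left associativity).
Reserved Notation "A ⋆ B" (at level 40, left associativity).
Reserved Notation "f ⋆₁ g" (at level 40, left associativity).
Reserved Notation "A ◇ B" (at level 40, left associativity).
Reserved Notation "f ◇₁ g" (at level 40, left associativity).

Record category := Category {
  ob :> Type;
  hom : ob -> ob -> Type;
  idm : forall A, hom A A;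
  comp : forall A B C, hom B C -> hom A B -> hom A C;
  comp_idl : forall A B (f : hom A B), comp (idm B) f = f;
  comp_idr : forall A B (f : hom A B), comp f (idm A) = f;
  comp_assoc : forall A B C D (h : hom C D) (g : hom B C) (f : hom A B),
    comp h (comp g f) = comp (comp h g) f
}.
Arguments idm {c} A.

Notation "A ~> B" := (hom A B).
Notation "g ∘ f" := (comp g f).

Record endofunctor (C : category) := Endofunctor {
  fob :> C -> C;
  fmap : forall A B : C, A ~> B -> fob A ~> fob B;
  fmap_id : forall A : C, fmap (idm A) = idm (fob A);
  fmap_comp : forall (A B D : C) (g : B ~> D) (f : A ~> B),
    fmap (g ∘ f) = fmap g ∘ fmap f
}.
Arguments fmap {C} e {A B} f.

Record contrafunctor (C : category) := Contrafunctor {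
  cob :> C -> C;
  cmap : forall A B : C, A ~> B -> cob B ~> cob A;
  cmap_id : forall A : C, cmap (idm A) = idm (cob A);
  cmap_comp : forall (A B D : C) (g : B ~> D) (f : A ~> B),
    cmap (g ∘ f) = cmap f ∘ cmap g
}.
Arguments cmap {C} c {A B} f.

(** Operations and axioms are kept apart throughout: the constructions between
    the two kinds of categories act on the operations only.  Monoidal
    structures are not assumed strict. *)

Record monoidal_ops (C : category) := MonoidalOps {
  ten : C -> C -> C;
  tenm : forall A A' B B' : C, A ~> A' -> B ~> B' -> ten A B ~> ten A' B';
  unt : C;
  asc : forall A B D : C, ten (ten A B) D ~> ten A (ten B D);
  asci : forall A B D : C, ten A (ten B D) ~> ten (ten A B) D;
  lun : forall A : C, ten unt A ~> A;
  luni : forall A : C, A ~> ten unt A;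
  run : forall A : C, ten A unt ~> A;
  runi : forall A : C, A ~> ten A unt
}.
Arguments ten {C} m A B.
Arguments tenm {C} m {A A' B B'} f g.
Arguments unt {C} m.
Arguments asc {C} m A B D.
Arguments asci {C} m A B D.
Arguments lun {C} m A.
Arguments luni {C} m A.
Arguments run {C} m A.
Arguments runi {C} m A.

Section MonoidalAxioms.
Context (C : category) (M : monoidal_ops C).
Local Notation "A ⋆ B" := (ten M A B).
Local Notation "f ⋆₁ g" := (tenm M f g).
Local Notation I := (unt M).

Record is_monoidal : Prop := {
  tenm_id : forall A B : C, idm A ⋆₁ idm B = idm (A ⋆ B);
  tenm_comp : forall (A A' A'' B B' B'' : C) (f' : A' ~> A'') (f : A ~> A')
      (g' : B' ~> B'') (g : B ~> B'),
    (f' ∘ f) ⋆₁ (g' ∘ g) = (f' ⋆₁ g') ∘ (f ⋆₁ g);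
  asc_nat : forall (A A' B B' D D' : C) (f : A ~> A') (g : B ~> B') (h : D ~> D'),
    asc M A' B' D' ∘ ((f ⋆₁ g) ⋆₁ h) = (f ⋆₁ (g ⋆₁ h)) ∘ asc M A B D;
  lun_nat : forall (A A' : C) (f : A ~> A'), lun M A' ∘ (idm I ⋆₁ f) = f ∘ lun M A;
  run_nat : forall (A A' : C) (f : A ~> A'), run M A' ∘ (f ⋆₁ idm I) = f ∘ run M A;
  asc_asci : forall A B D : C, asc M A B D ∘ asci M A B D = idm _;
  asci_asc : forall A B D : C, asci M A B D ∘ asc M A B D = idm _;
  lun_luni : forall A : C, lun M A ∘ luni M A = idm _;
  luni_lun : forall A : C, luni M A ∘ lun M A = idm _;
  run_runi : forall A : C, run M A ∘ runi M A = idm _;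
  runi_run : forall A : C, runi M A ∘ run M A = idm _;
  pentagon : forall A B D E : C,
    asc M A B (D ⋆ E) ∘ asc M (A ⋆ B) D E
    = (idm A ⋆₁ asc M B D E) ∘ asc M A (B ⋆ D) E ∘ (asc M A B D ⋆₁ idm E);
  triangle : forall A B : C,
    (idm A ⋆₁ lun M B) ∘ asc M A I B = run M A ⋆₁ idm B
}.

End MonoidalAxioms.

Record ldn_ops (C : category) := LdnOps {
  star : monoidal_ops C;
  par : monoidal_ops C;
  distl : forall A B D : C, ten star A (ten par B D) ~> ten par (ten star A B) D;
  distr : forall B D A : C, ten star (ten par B D) A ~> ten par B (ten star D A);
  ldn_S : contrafunctor C;
  ldn_S' : contrafunctor C;
  ldn_e : forall A : C, ten star (ldn_S A) A ~> unt par;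
  ldn_e' : forall A : C, ten star A (ldn_S' A) ~> unt par;
  ldn_n : forall A : C, unt star ~> ten par A (ldn_S A);
  ldn_n' : forall A : C, unt star ~> ten par (ldn_S' A) A
}.
Arguments distl {C} l A B D.
Arguments distr {C} l B D A.
Arguments ldn_S {C} l.
Arguments ldn_S' {C} l.
Arguments ldn_e {C} l A.
Arguments ldn_e' {C} l A.
Arguments ldn_n {C} l A.
Arguments ldn_n' {C} l A.

Section LDN.
Context (C : category) (L : ldn_ops C).
Local Notation "A ⋆ B" := (ten (star L) A B).
Local Notation "f ⋆₁ g" := (tenm (star L) f g).
Local Notation "A ◇ B" := (ten (par L) A B).
Local Notation "f ◇₁ g" := (tenm (par L) f g).
Local Notation I := (unt (star L)).
Local Notation J := (unt (par L)).
Local Notation S := (ldn_S L).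
Local Notation S' := (ldn_S' L).
Local Notation e := (ldn_e L).
Local Notation e' := (ldn_e' L).
Local Notation n := (ldn_n L).
Local Notation n' := (ldn_n' L).

(** [(1 ◇ y) ∂_r (x ⋆ 1)] with the unit isomorphisms at both ends inserted. *)
Definition zigr (A B D : C) (x : I ~> B ◇ D) (y : D ⋆ A ~> J) : A ~> B :=
  run (par L) B ∘ (idm B ◇₁ y) ∘ distr L B D A ∘ (x ⋆₁ idm A) ∘ luni (star L) A.

(** [(y ◇ 1) ∂_l (1 ⋆ x)] with the unit isomorphisms at both ends inserted. *)
Definition zigl (A B D : C) (x : I ~> B ◇ D) (y : A ⋆ B ~> J) : A ~> D :=
  lun (par L) D ∘ (y ◇₁ idm D) ∘ distl L A B D ∘ (idm A ⋆₁ x) ∘ runi (star L) A.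

Record is_ldn : Prop := {
  ldn_star : is_monoidal (star L);
  ldn_par : is_monoidal (par L);

  distl_nat : forall (A A' B B' D D' : C) (f : A ~> A') (g : B ~> B') (h : D ~> D'),
    distl L A' B' D' ∘ (f ⋆₁ (g ◇₁ h)) = ((f ⋆₁ g) ◇₁ h) ∘ distl L A B D;
  distr_nat : forall (A A' B B' D D' : C) (f : A ~> A') (g : B ~> B') (h : D ~> D'),
    distr L B' D' A' ∘ ((g ◇₁ h) ⋆₁ f) = (g ◇₁ (h ⋆₁ f)) ∘ distr L B D A;

  distl_unit_star : forall B D : C,
    (lun (star L) B ◇₁ idm D) ∘ distl L I B D = lun (star L) (B ◇ D);
  distl_unit_par : forall A B : C,
    run (par L) (A ⋆ B) ∘ distl L A B J = idm A ⋆₁ run (par L) B;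
  distr_unit_star : forall B D : C,
    (idm B ◇₁ run (star L) D) ∘ distr L B D I = run (star L) (B ◇ D);
  distr_unit_par : forall D A : C,
    lun (par L) (D ⋆ A) ∘ distr L J D A = lun (par L) D ⋆₁ idm A;

  distl_star : forall A B D E : C,
    (asc (star L) A B D ◇₁ idm E) ∘ distl L (A ⋆ B) D E
    = distl L A (B ⋆ D) E ∘ (idm A ⋆₁ distl L B D E) ∘ asc (star L) A B (D ◇ E);
  distl_par : forall A B D E : C,
    asc (par L) (A ⋆ B) D E ∘ (distl L A B D ◇₁ idm E) ∘ distl L A (B ◇ D) E
    = distl L A B (D ◇ E) ∘ (idm A ⋆₁ asc (par L) B D E);
  distr_star : forall B D A E : C,
    (idm B ◇₁ asc (star L) D A E) ∘ distr L B (D ⋆ A) E ∘ (distr L B D A ⋆₁ idm E)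
    = distr L B D (A ⋆ E) ∘ asc (star L) (B ◇ D) A E;
  distr_par : forall B D E A : C,
    asc (par L) B D (E ⋆ A) ∘ distr L (B ◇ D) E A
    = (idm B ◇₁ distr L D E A) ∘ distr L B (D ◇ E) A ∘ (asc (par L) B D E ⋆₁ idm A);
  distl_distr_star : forall A B D E : C,
    distr L (A ⋆ B) D E ∘ (distl L A B D ⋆₁ idm E)
    = distl L A B (D ⋆ E) ∘ (idm A ⋆₁ distr L B D E) ∘ asc (star L) A (B ◇ D) E;
  distl_distr_par : forall A B D E : C,
    asc (par L) A (B ⋆ D) E ∘ (distr L A B D ◇₁ idm E) ∘ distl L (A ◇ B) D E
    = (idm A ◇₁ distl L B D E) ∘ distr L A B (D ◇ E);

  ldn_e_dinat : forall (A B : C) (f : A ~> B),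
    e A ∘ (cmap S f ⋆₁ idm A) = e B ∘ (idm (S B) ⋆₁ f);
  ldn_e'_dinat : forall (A B : C) (f : A ~> B),
    e' A ∘ (idm A ⋆₁ cmap S' f) = e' B ∘ (f ⋆₁ idm (S' B));
  ldn_n_dinat : forall (A B : C) (f : A ~> B),
    (f ◇₁ idm (S A)) ∘ n A = (idm B ◇₁ cmap S f) ∘ n B;
  ldn_n'_dinat : forall (A B : C) (f : A ~> B),
    (idm (S' A) ◇₁ f) ∘ n' A = (cmap S' f ◇₁ idm B) ∘ n' B;

  ldn_triangle1 : forall A : C, zigr (n A) (e A) = idm A;
  ldn_triangle2 : forall A : C, zigl (n A) (e A) = idm (S A);
  ldn_triangle3 : forall A : C, zigl (n' A) (e' A) = idm A;
  ldn_triangle4 : forall A : C, zigr (n' A) (e' A) = idm (S' A)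
}.

End LDN.

(** [sa_ev A B] and [sa_ev' B A] are the morphisms [e_{A,B}] and [e'_{B,A}]
    which encode the isomorphisms [C(A ⊗ B, S D) ≅ C(A, S (B ⊗ D))]. *)

Record sa_ops (C : category) := SaOps {
  sa_ten : monoidal_ops C;
  sa_S : contrafunctor C;
  sa_S' : contrafunctor C;
  sa_eta : forall A : C, A ~> sa_S' (sa_S A);
  sa_etai : forall A : C, sa_S' (sa_S A) ~> A;
  sa_kap : forall A : C, A ~> sa_S (sa_S' A);
  sa_kapi : forall A : C, sa_S (sa_S' A) ~> A;
  sa_ev : forall A B : C, ten sa_ten (sa_S (ten sa_ten A B)) A ~> sa_S B;
  sa_ev' : forall B A : C, ten sa_ten B (sa_S' (ten sa_ten A B)) ~> sa_S' A
}.
Arguments sa_ten {C} s.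
Arguments sa_S {C} s.
Arguments sa_S' {C} s.
Arguments sa_eta {C} s A.
Arguments sa_etai {C} s A.
Arguments sa_kap {C} s A.
Arguments sa_kapi {C} s A.
Arguments sa_ev {C} s A B.
Arguments sa_ev' {C} s B A.

Section StarAutonomous.
Context (C : category) (X : sa_ops C).
Local Notation "A ⋆ B" := (ten (sa_ten X) A B).
Local Notation "f ⋆₁ g" := (tenm (sa_ten X) f g).
Local Notation S := (sa_S X).
Local Notation S' := (sa_S' X).

(** Isomorphisms [C(A ⊗ B, S D) ≅ C(A, S (B ⊗ D))] natural in [A], [B], [D].
    No compatibility with [asc] is required. *)
Record sa_hom_iso := {
  cur : forall A B D : C, A ⋆ B ~> S D -> A ~> S (B ⋆ D);
  unc : forall A B D : C, A ~> S (B ⋆ D) -> A ⋆ B ~> S D;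
  cur_unc : forall (A B D : C) (g : A ~> S (B ⋆ D)), cur (unc g) = g;
  unc_cur : forall (A B D : C) (f : A ⋆ B ~> S D), unc (cur f) = f;
  cur_nat1 : forall (A A' B D : C) (a : A ~> A') (f : A' ⋆ B ~> S D),
    cur (f ∘ (a ⋆₁ idm B)) = cur f ∘ a;
  cur_nat2 : forall (A B B' D : C) (b : B ~> B') (f : A ⋆ B' ~> S D),
    cur (f ∘ (idm A ⋆₁ b)) = cmap S (b ⋆₁ idm D) ∘ cur f;
  cur_nat3 : forall (A B D D' : C) (d : D ~> D') (f : A ⋆ B ~> S D'),
    cur (cmap S d ∘ f) = cmap S (idm B ⋆₁ d) ∘ cur f
}.

Record is_star_autonomous : Prop := {
  sa_monoidal : is_monoidal (sa_ten X);

  sa_eta_nat : forall (A B : C) (f : A ~> B),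
    sa_eta X B ∘ f = cmap S' (cmap S f) ∘ sa_eta X A;
  sa_eta_etai : forall A : C, sa_eta X A ∘ sa_etai X A = idm _;
  sa_etai_eta : forall A : C, sa_etai X A ∘ sa_eta X A = idm _;
  sa_kap_nat : forall (A B : C) (f : A ~> B),
    sa_kap X B ∘ f = cmap S (cmap S' f) ∘ sa_kap X A;
  sa_kap_kapi : forall A : C, sa_kap X A ∘ sa_kapi X A = idm _;
  sa_kapi_kap : forall A : C, sa_kapi X A ∘ sa_kap X A = idm _;
  sa_adj_S : forall A : C, cmap S (sa_eta X A) ∘ sa_kap X (S A) = idm (S A);
  sa_adj_S' : forall A : C, cmap S' (sa_kap X A) ∘ sa_eta X (S' A) = idm (S' A);

  (** [sa_ev A B] is the transpose of the identity of [S (A ⋆ B)], and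
      [sa_ev' B A] that of the identity of [S' (A ⋆ B)] under
      [C(D, S' (A ⋆ B)) ≅ C(A ⋆ B, S D) ≅ C(A, S (B ⋆ D)) ≅ C(B ⋆ D, S' A)]. *)
  sa_hom : exists h : sa_hom_iso,
    (forall A B : C, sa_ev X A B = unc h (idm (S (A ⋆ B)))) /\
    (forall B A : C, sa_ev' X B A
       = cmap S' (cur h (sa_kap X (A ⋆ B))) ∘ sa_eta X (B ⋆ S' (A ⋆ B)))
}.

End StarAutonomous.

Section SaOfLdn.
Context (C : category) (L : ldn_ops C).
Local Notation "A ⋆ B" := (ten (star L) A B).
Local Notation S := (ldn_S L).
Local Notation S' := (ldn_S' L).
Local Notation e := (ldn_e L).
Local Notation e' := (ldn_e' L).
Local Notation n := (ldn_n L).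
Local Notation n' := (ldn_n' L).

Definition sa_of_ldn : sa_ops C := {|
  sa_ten := star L;
  sa_S := S;
  sa_S' := S';
  sa_eta A := zigr (n' (S A)) (e A);
  sa_etai A := zigr (n A) (e' (S A));
  sa_kap A := zigl (n (S' A)) (e' A);
  sa_kapi A := zigl (n' A) (e (S' A));
  sa_ev A B := zigl (n B) (e (A ⋆ B) ∘ asc (star L) (S (A ⋆ B)) A B);
  sa_ev' B A := zigr (n' A) (e' (A ⋆ B) ∘ asci (star L) A B (S' (A ⋆ B)))
|}.

End SaOfLdn.

Section LdnOfSa.
Context (C : category) (X : sa_ops C).
Local Notation M := (sa_ten X).
Local Notation "A ⋆ B" := (ten M A B).
Local Notation "f ⋆₁ g" := (tenm M f g).
Local Notation I := (unt M).
Local Notation S := (sa_S X).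
Local Notation S' := (sa_S' X).
Local Notation η := (sa_eta X).
Local Notation ηi := (sa_etai X).
Local Notation κ := (sa_kap X).
Local Notation κi := (sa_kapi X).
Local Notation ev := (sa_ev X).
Local Notation ev' := (sa_ev' X).

(** The canonical isomorphism [S' I ≅ S I]. *)
Definition unit_iso : S' I ~> S I :=
  ev (S' I) I ∘ ((cmap S (run M (S' I)) ∘ κ I) ⋆₁ idm (S' I)) ∘ luni M (S' I).
Definition unit_isoi : S I ~> S' I :=
  ev' (S I) I ∘ (idm (S I) ⋆₁ (cmap S' (lun M (S I)) ∘ η I)) ∘ runi M (S I).

Definition SSI_of_I : I ~> S (S I) := cmap S unit_isoi ∘ κ I.
Definition I_of_SSI : S (S I) ~> I := κi I ∘ cmap S unit_iso.

(** [A ◇ B = S' (S B ⋆ S A)] and [J = S I]; all structure isomorphisms are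
    transported along [S S' ≅ 1 ≅ S' S] and [S S I ≅ I]. *)
Definition par_of_sa : monoidal_ops C := {|
  ten A B := S' (S B ⋆ S A);
  tenm A A' B B' f g := cmap S' (cmap S g ⋆₁ cmap S f);
  unt := S I;
  asc A B D :=
    cmap S' (κi (S D ⋆ S B) ⋆₁ idm (S A)) ∘ cmap S' (asc M (S D) (S B) (S A))
    ∘ cmap S' (idm (S D) ⋆₁ κ (S B ⋆ S A));
  asci A B D :=
    cmap S' (idm (S D) ⋆₁ κi (S B ⋆ S A)) ∘ cmap S' (asci M (S D) (S B) (S A))
    ∘ cmap S' (κ (S D ⋆ S B) ⋆₁ idm (S A));
  lun A := ηi A ∘ cmap S' (runi M (S A)) ∘ cmap S' (idm (S A) ⋆₁ SSI_of_I);
  luni A := cmap S' (idm (S A) ⋆₁ I_of_SSI) ∘ cmap S' (run M (S A)) ∘ η A;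
  run A := ηi A ∘ cmap S' (luni M (S A)) ∘ cmap S' (SSI_of_I ⋆₁ idm (S A));
  runi A := cmap S' (I_of_SSI ⋆₁ idm (S A)) ∘ cmap S' (lun M (S A)) ∘ η A
|}.
Local Notation "A ◇ B" := (ten par_of_sa A B).

(** The canonical isomorphism [S' (S B ⋆ S A) ≅ S (S' B ⋆ S' A)].  By Yoneda
    it comes from the natural bijections
    [C(Z, S' (S B ⋆ S A)) ≅ C(S B ⋆ S A, S Z) ≅ C(S A ⋆ Z, B)
     ≅ C(Z ⋆ S' B, A) ≅ C(Z, S (S' B ⋆ S' A))]. *)
Definition par_ev_r (A B : C) : (A ◇ B) ⋆ S' B ~> A :=
  ηi A ∘ ev' (A ◇ B) (S A)
  ∘ (idm (A ◇ B) ⋆₁ cmap S' (ηi B ∘ ev' (S A) (S B))).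
Definition par_swap (A B : C) : A ◇ B ~> S (S' B ⋆ S' A) :=
  cmap S (idm (S' B) ⋆₁ cmap S' (par_ev_r A B))
  ∘ cmap S (ev' (S' B) (A ◇ B)) ∘ κ (A ◇ B).

Definition par_ev_l (A B : C) : S A ⋆ S (S' B ⋆ S' A) ~> B :=
  κi B ∘ ev (S (S' B ⋆ S' A)) (S' B)
  ∘ (cmap S (κi A ∘ ev (S' B) (S' A)) ⋆₁ idm (S (S' B ⋆ S' A))).
Definition par_swapi (A B : C) : S (S' B ⋆ S' A) ~> A ◇ B :=
  cmap S' (ev (S A) (S (S' B ⋆ S' A)) ∘ (cmap S (par_ev_l A B) ⋆₁ idm (S A)))
  ∘ η (S (S' B ⋆ S' A)).

Definition distl_of_sa (A B D : C) : A ⋆ (B ◇ D) ~> (A ⋆ B) ◇ D :=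
  ev' A (S D ⋆ S (A ⋆ B))
  ∘ (idm A ⋆₁ (cmap S' (asc M (S D) (S (A ⋆ B)) A)
               ∘ cmap S' (idm (S D) ⋆₁ ev A B))).

Definition distr_of_sa (B D A : C) : (B ◇ D) ⋆ A ~> B ◇ (D ⋆ A) :=
  par_swapi B (D ⋆ A)
  ∘ ev A (S' (D ⋆ A) ⋆ S' B)
  ∘ ((cmap S (asci M A (S' (D ⋆ A)) (S' B))
      ∘ cmap S (ev' A D ⋆₁ idm (S' B))) ⋆₁ idm A)
  ∘ (par_swap B D ⋆₁ idm A).

(** [e_{A,I} : S A ⋆ A -> S I] and [e'_{A,I} : A ⋆ S' A -> S' I]. *)
Definition ev_unit (A : C) : S A ⋆ A ~> S I :=
  ev A I ∘ (cmap S (run M A) ⋆₁ idm A).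
Definition ev'_unit (A : C) : A ⋆ S' A ~> S' I :=
  ev' A I ∘ (idm A ⋆₁ cmap S' (lun M A)).

Definition ldn_of_sa : ldn_ops C := {|
  star := M;
  par := par_of_sa;
  distl := distl_of_sa;
  distr := distr_of_sa;
  ldn_S := S;
  ldn_S' := S';
  ldn_e := ev_unit;
  ldn_e' A := unit_iso ∘ ev'_unit A;
  ldn_n A := par_swapi A (S A) ∘ cmap S (ηi A ⋆₁ idm (S' A))
             ∘ cmap S (ev'_unit A) ∘ κ I;
  ldn_n' A := cmap S' (idm (S A) ⋆₁ κi A) ∘ cmap S' (ev_unit A) ∘ η I
|}.

End LdnOfSa.

Record comonad (C : category) := Comonad {
  cmd_G :> endofunctor C;
  delta : forall A : C, cmd_G A ~> cmd_G (cmd_G A);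
  eps : forall A : C, cmd_G A ~> A;
  delta_nat : forall (A B : C) (f : A ~> B),
    delta B ∘ fmap cmd_G f = fmap cmd_G (fmap cmd_G f) ∘ delta A;
  eps_nat : forall (A B : C) (f : A ~> B), eps B ∘ fmap cmd_G f = f ∘ eps A;
  delta_assoc : forall A : C, delta (cmd_G A) ∘ delta A = fmap cmd_G (delta A) ∘ delta A;
  delta_epsl : forall A : C, eps (cmd_G A) ∘ delta A = idm (cmd_G A);
  delta_epsr : forall A : C, fmap cmd_G (eps A) ∘ delta A = idm (cmd_G A)
}.
Arguments delta {C} c A.
Arguments eps {C} c A.

Record coalgebra (C : category) (G : comonad C) := Coalgebra {
  coalg_ob :> C;
  coalg_str : coalg_ob ~> G coalg_ob;
  coalg_eps : eps G coalg_ob ∘ coalg_str = idm coalg_ob;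
  coalg_delta : delta G coalg_ob ∘ coalg_str = fmap G coalg_str ∘ coalg_str
}.

Record lax_ops (C : category) (G : endofunctor C) (M : monoidal_ops C) := LaxOps {
  lax2 :> forall A B : C, ten M (G A) (G B) ~> G (ten M A B);
  lax0 : unt M ~> G (unt M)
}.
Arguments lax0 {C G M} l.

Section Comonads.
Context (C : category) (G : comonad C).

Section MonoidalComonad.
Context (M : monoidal_ops C) (φ : lax_ops G M).
Local Notation "A ⋆ B" := (ten M A B).
Local Notation "f ⋆₁ g" := (tenm M f g).
Local Notation I := (unt M).
Local Notation φ0 := (lax0 φ).

Record monoidal_comonad : Prop := {
  lax2_nat : forall (A A' B B' : C) (f : A ~> A') (g : B ~> B'),
    φ A' B' ∘ (fmap G f ⋆₁ fmap G g) = fmap G (f ⋆₁ g) ∘ φ A B;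
  lax_asc : forall A B D : C,
    fmap G (asc M A B D) ∘ φ (A ⋆ B) D ∘ (φ A B ⋆₁ idm (G D))
    = φ A (B ⋆ D) ∘ (idm (G A) ⋆₁ φ B D) ∘ asc M (G A) (G B) (G D);
  lax_lun : forall A : C,
    fmap G (lun M A) ∘ φ I A ∘ (φ0 ⋆₁ idm (G A)) = lun M (G A);
  lax_run : forall A : C,
    fmap G (run M A) ∘ φ A I ∘ (idm (G A) ⋆₁ φ0) = run M (G A);
  delta_lax2 : forall A B : C,
    delta G (A ⋆ B) ∘ φ A B
    = fmap G (φ A B) ∘ φ (G A) (G B) ∘ (delta G A ⋆₁ delta G B);
  delta_lax0 : delta G I ∘ φ0 = fmap G φ0 ∘ φ0;
  eps_lax2 : forall A B : C, eps G (A ⋆ B) ∘ φ A B = eps G A ⋆₁ eps G B;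
  eps_lax0 : eps G I ∘ φ0 = idm I
}.

End MonoidalComonad.

Record lifting (S : contrafunctor C) (ν : forall A : C, S A ~> G (S (G A))) : Prop := {
  lifting_nat : forall (A B : C) (f : A ~> B),
    ν A ∘ cmap S f = fmap G (cmap S (fmap G f)) ∘ ν B;
  lifting_eps : forall A : C, eps G (S (G A)) ∘ ν A = cmap S (eps G A);
  lifting_delta : forall A : C,
    delta G (S (G A)) ∘ ν A
    = fmap G (fmap G (cmap S (delta G A))) ∘ fmap G (ν (G A)) ∘ ν A
}.

Section LdnComonad.
Context (L : ldn_ops C).
Local Notation "A ⋆ B" := (ten (star L) A B).
Local Notation "f ⋆₁ g" := (tenm (star L) f g).
Local Notation "A ◇ B" := (ten (par L) A B).
Local Notation "f ◇₁ g" := (tenm (par L) f g).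
Local Notation S := (ldn_S L).
Local Notation S' := (ldn_S' L).
Local Notation e := (ldn_e L).
Local Notation e' := (ldn_e' L).
Local Notation n := (ldn_n L).
Local Notation n' := (ldn_n' L).
Context (φ : lax_ops G (star L)) (ψ : lax_ops G (par L)).
Context (ν : forall A : C, S A ~> G (S (G A))) (ν' : forall A : C, S' A ~> G (S' (G A))).

Record ldn_comonad : Prop := {
  ldn_lax_star : monoidal_comonad φ;
  ldn_lax_par : monoidal_comonad ψ;
  ldn_distl : forall A B D : coalgebra G,
    fmap G (distl L A B D) ∘ φ A (B ◇ D) ∘ (idm (G A) ⋆₁ ψ B D)
    = ψ (A ⋆ B) D ∘ (φ A B ◇₁ idm (G D)) ∘ distl L (G A) (G B) (G D);
  ldn_distr : forall A B D : coalgebra G,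
    fmap G (distr L B D A) ∘ φ (B ◇ D) A ∘ (ψ B D ⋆₁ idm (G A))
    = ψ B (D ⋆ A) ∘ (idm (G B) ◇₁ φ D A) ∘ distr L (G B) (G D) (G A);
  ldn_lift : lifting ν;
  ldn_lift' : lifting ν';
  ldn_lift_e : forall A : C,
    lax0 ψ ∘ e A ∘ (idm (S A) ⋆₁ eps G A)
    = fmap G (e (G A)) ∘ φ (S (G A)) (G A) ∘ (ν A ⋆₁ delta G A);
  ldn_lift_n : forall A : C,
    fmap G (idm A ◇₁ cmap S (eps G A)) ∘ fmap G (n A) ∘ lax0 φ
    = fmap G (idm A ◇₁ cmap S (delta G A)) ∘ ψ A (S (G (G A)))
      ∘ (idm (G A) ◇₁ ν (G A)) ∘ n (G A);
  ldn_lift_e' : forall A : C,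
    lax0 ψ ∘ e' A ∘ (eps G A ⋆₁ idm (S' A))
    = fmap G (e' (G A)) ∘ φ (G A) (S' (G A)) ∘ (delta G A ⋆₁ ν' A);
  ldn_lift_n' : forall A : C,
    fmap G (cmap S' (eps G A) ◇₁ idm A) ∘ fmap G (n' A) ∘ lax0 φ
    = fmap G (cmap S' (delta G A) ◇₁ idm A) ∘ ψ (S' (G (G A))) A
      ∘ (ν' (G A) ◇₁ idm (G A)) ∘ n' (G A)
}.

End LdnComonad.

Section SaComonad.
Context (X : sa_ops C).
Local Notation "A ⋆ B" := (ten (sa_ten X) A B).
Local Notation "f ⋆₁ g" := (tenm (sa_ten X) f g).
Local Notation S := (sa_S X).
Local Notation S' := (sa_S' X).
Local Notation ev := (sa_ev X).
Local Notation ev' := (sa_ev' X).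
Context (φ : lax_ops G (sa_ten X)).
Context (ν : forall A : C, S A ~> G (S (G A))) (ν' : forall A : C, S' A ~> G (S' (G A))).

Record sa_comonad : Prop := {
  sa_lax : monoidal_comonad φ;
  sa_lift : lifting ν;
  sa_lift' : lifting ν';
  sa_lift_kap : forall A : C,
    fmap G (cmap S (ν' A)) ∘ ν (S' (G A)) = fmap G (sa_kap X A) ∘ sa_kapi X (G A);
  sa_lift_eta : forall A : C,
    fmap G (cmap S' (ν A)) ∘ ν' (S (G A)) = fmap G (sa_eta X A) ∘ sa_etai X (G A);
  sa_lift_ev : forall A B : C,
    ν B ∘ ev A B ∘ (idm (S (A ⋆ B)) ⋆₁ eps G A)
    = fmap G (ev (G A) (G B)) ∘ fmap G (cmap S (φ A B) ⋆₁ idm (G A))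
      ∘ φ (S (G (A ⋆ B))) (G A) ∘ (ν (A ⋆ B) ⋆₁ delta G A);
  sa_lift_ev' : forall A B : C,
    ν' A ∘ ev' B A ∘ (eps G B ⋆₁ idm (S' (A ⋆ B)))
    = fmap G (ev' (G B) (G A)) ∘ fmap G (idm (G B) ⋆₁ cmap S' (φ A B))
      ∘ φ (G B) (S' (G (A ⋆ B))) ∘ (delta G B ⋆₁ ν' (A ⋆ B))
}.

End SaComonad.

End Comonads.

(* Main.v *)
From Corelib Require Import ssreflect ssrfun.
Require Import Defs.

Set Implicit Arguments.
Unset Strict Implicit.
Unset Printing Implicit Defensive.

(** Each condition on the comonad says that some structure map lifts to the
    category of [G]-coalgebras: it is recovered from the coalgebra map at cofree
    coalgebras by composing with counits and using (di)naturality.  Since the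
    structure maps of either kind of category are composites of those of the
    other, one set of lifts yields the other.  Beyond naturality, only
    [κ κi = 1] and [η ηi = 1] in a linearly distributive category with negations
    are needed; for the converse, [A ◇ B] and [J] acquire coalgebra structures
    as [S' (S B ⋆ S A)] and [S I], which forces the choice of [ψ]. *)

(** Composites are kept left-associated, so two adjacent factors are in general not a subterm; this
    form lets an equation between such factors rewrite inside a longer chain. *)
Lemma comp_pre (C : category) (A B D E : C) (g : B ~> D) (f : A ~> B) (k : A ~> D) :
  g ∘ f = k -> forall h : D ~> E, h ∘ g ∘ f = h ∘ k.
Proof. by move=> <- h; rewrite comp_assoc. Qed.

Lemma inverse_nat (C : category) (A A' B B' : C) (p : A ~> B) (pi : B ~> A) (q : A' ~> B')
    (qi : B' ~> A') (f : A ~> A') (g : B ~> B') :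
  p ∘ pi = idm B -> qi ∘ q = idm A' -> q ∘ f = g ∘ p -> qi ∘ g = f ∘ pi.
Proof.
move=> ppi qiq E.
by rewrite -(comp_idr g) -ppi (comp_assoc g) -E !comp_assoc qiq comp_idl.
Qed.

(** * Monoidal categories: inverse constraints and coherence at the unit *)

Section Monoidal.
Context (C : category) (M : monoidal_ops C) (HM : is_monoidal M).
Local Notation "A ⋆ B" := (ten M A B).
Local Notation "f ⋆₁ g" := (tenm M f g).
Local Notation I := (unt M).

Lemma tenm_merge (A A' A'' B B' B'' : C) (f' : A' ~> A'') (f : A ~> A')
    (g' : B' ~> B'') (g : B ~> B') :
  (f' ⋆₁ g') ∘ (f ⋆₁ g) = (f' ∘ f) ⋆₁ (g' ∘ g).
Proof. by rewrite (tenm_comp HM). Qed.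

Lemma tenm_merge_pre (A A' A'' B B' B'' E : C) (f' : A' ~> A'') (f : A ~> A')
    (g' : B' ~> B'') (g : B ~> B') (h : A'' ⋆ B'' ~> E) :
  h ∘ (f' ⋆₁ g') ∘ (f ⋆₁ g) = h ∘ ((f' ∘ f) ⋆₁ (g' ∘ g)).
Proof. by rewrite -comp_assoc tenm_merge. Qed.

Lemma asci_nat (A A' B B' D D' : C) (f : A ~> A') (g : B ~> B') (h : D ~> D') :
  asci M A' B' D' ∘ (f ⋆₁ (g ⋆₁ h)) = ((f ⋆₁ g) ⋆₁ h) ∘ asci M A B D.
Proof. exact: inverse_nat (asc_asci HM _ _ _) (asci_asc HM _ _ _) (asc_nat HM f g h). Qed.

Lemma luni_nat (A A' : C) (f : A ~> A') : luni M A' ∘ f = (idm I ⋆₁ f) ∘ luni M A.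
Proof. exact: inverse_nat (lun_luni HM _) (luni_lun HM _) (lun_nat HM f). Qed.

Lemma runi_nat (A A' : C) (f : A ~> A') : runi M A' ∘ f = (f ⋆₁ idm I) ∘ runi M A.
Proof. exact: inverse_nat (run_runi HM _) (runi_run HM _) (run_nat HM f). Qed.

Lemma tenm_comp_l (A A' A'' B : C) (f' : A' ~> A'') (f : A ~> A') :
  (f' ∘ f) ⋆₁ idm B = (f' ⋆₁ idm B) ∘ (f ⋆₁ idm B).
Proof. by rewrite tenm_merge comp_idl. Qed.

Lemma tenm_comp_r (A B B' B'' : C) (f' : B' ~> B'') (f : B ~> B') :
  idm A ⋆₁ (f' ∘ f) = (idm A ⋆₁ f') ∘ (idm A ⋆₁ f).
Proof. by rewrite tenm_merge comp_idl. Qed.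

Lemma asc_runi (A B : C) : asc M A I B ∘ (runi M A ⋆₁ idm B) = idm A ⋆₁ luni M B.
Proof.
rewrite -[LHS]comp_idl -(tenm_id HM) -(luni_lun HM) tenm_comp_r comp_assoc (comp_pre (triangle HM _ _)).
by rewrite -comp_assoc tenm_merge (run_runi HM) comp_idl (tenm_id HM) comp_idr.
Qed.

Lemma unt_tenm_inj (A B : C) (f g : A ~> B) : idm I ⋆₁ f = idm I ⋆₁ g -> f = g.
Proof.
move=> E.
by rewrite -(comp_idr f) -(comp_idr g) -(lun_luni HM) !comp_assoc -!(lun_nat HM) E.
Qed.

Lemma tenm_unt_inj (A B : C) (f g : A ~> B) : f ⋆₁ idm I = g ⋆₁ idm I -> f = g.
Proof.
move=> E.
by rewrite -(comp_idr f) -(comp_idr g) -(run_runi HM) !comp_assoc -!(run_nat HM) E.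
Qed.

(** Kelly's argument: tensoring with [I] on the left is faithful, and after that the claim is the
    pentagon with two unit entries, whose remaining edges are settled by the triangle and by
    naturality of [asc]. *)
Lemma lun_ten (A B : C) : lun M (A ⋆ B) ∘ asc M I A B = lun M A ⋆₁ idm B.
Proof.
apply: unt_tenm_inj.
(* Both associators are invertible, so the equation may be tested after precomposing with them; this
   supplies the missing edges of the pentagon. *)
have epi : forall (Z : C) (u v : I ⋆ ((I ⋆ A) ⋆ B) ~> Z),
    u ∘ (asc M I (I ⋆ A) B ∘ (asc M I I A ⋆₁ idm B))
    = v ∘ (asc M I (I ⋆ A) B ∘ (asc M I I A ⋆₁ idm B)) -> u = v.
  move=> Z u v E.
  have S1 : forall w : I ⋆ ((I ⋆ A) ⋆ B) ~> Z,
      w ∘ (asc M I (I ⋆ A) B ∘ (asc M I I A ⋆₁ idm B))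
        ∘ ((asci M I I A ⋆₁ idm B) ∘ asci M I (I ⋆ A) B) = w.
    move=> w.
    rewrite !comp_assoc tenm_merge_pre (asc_asci HM) comp_idl (tenm_id HM) comp_idr.
    by rewrite (comp_pre (asc_asci HM _ _ _)) comp_idr.
  by rewrite -(S1 u) -(S1 v) E.
apply: epi.
rewrite -{1}(comp_idl (idm I)) (tenm_comp HM) !comp_assoc.
have P := pentagon HM I I A B.
rewrite -!comp_assoc [_ ∘ (asc _ _ _ _ ∘ _)]comp_assoc -P comp_assoc.
rewrite (triangle HM) -(tenm_id HM) -(asc_nat HM) comp_assoc -(asc_nat HM).
by rewrite (tenm_merge_pre) (triangle HM) comp_idl.
Qed.

(** After tensoring with [I] on the right, [lun_ten] and [triangle] reduce the claim to
    [lun M (I ⋆ I) = idm I ⋆₁ lun M I], which is naturality of [lun] at the invertible map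
    [lun M I]. *)
Lemma lun_run_unt : lun M I = run M I.
Proof.
apply: tenm_unt_inj; rewrite -lun_ten -(triangle HM); congr (_ ∘ _).
rewrite -[LHS]comp_idl -[RHS]comp_idl -(luni_lun HM).
by rewrite -!comp_assoc (lun_nat HM).
Qed.

End Monoidal.

Lemma fmap_cmap (C : category) (G : endofunctor C) (S : contrafunctor C) (A B D : C)
    (g : B ~> D) (f : A ~> B) :
  fmap G (cmap S (g ∘ f)) = fmap G (cmap S f) ∘ fmap G (cmap S g).
Proof. by rewrite cmap_comp fmap_comp. Qed.

(** * Coalgebras of the comonad and the lifted monoidal structure *)

Section Coalgebras.
Context (C : category) (G : comonad C).

Definition coalg_map (A B : coalgebra G) (f : A ~> B) : Prop :=
  fmap G f ∘ coalg_str A = coalg_str B ∘ f.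

Lemma id_map (A : coalgebra G) : coalg_map (idm A).
Proof. by rewrite /coalg_map fmap_id comp_idl comp_idr. Qed.

Lemma comp_map (A B D : coalgebra G) (g : B ~> D) (f : A ~> B) :
  coalg_map g -> coalg_map f -> coalg_map (g ∘ f).
Proof.
by rewrite /coalg_map => Hg Hf; rewrite fmap_comp -comp_assoc Hf !comp_assoc Hg.
Qed.

Lemma inv_map (A B : coalgebra G) (f : A ~> B) (g : B ~> A) :
  g ∘ f = idm A -> f ∘ g = idm B -> coalg_map f -> coalg_map g.
Proof.
rewrite /coalg_map => gf fg Hf.
rewrite -[LHS]comp_idr -{1}fg comp_assoc (comp_pre (esym Hf)) comp_assoc -fmap_comp gf.
by rewrite fmap_id comp_idl.
Qed.

Definition cofree (A : C) : coalgebra G := Coalgebra (delta_epsl G A) (delta_assoc G A).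

Section Tensor.
Context (M : monoidal_ops C) (φ : lax_ops G M).
Context (HM : is_monoidal M) (Hφ : monoidal_comonad φ).
Local Notation "A ⋆ B" := (ten M A B).
Local Notation "f ⋆₁ g" := (tenm M f g).

Lemma lax2_pull (A A' B B' U V : C) (f : A ~> A') (g : B ~> B') (u : U ~> G A) (v : V ~> G B) :
  φ A' B' ∘ ((fmap G f ∘ u) ⋆₁ (fmap G g ∘ v)) = fmap G (f ⋆₁ g) ∘ φ A B ∘ (u ⋆₁ v).
Proof. by rewrite (tenm_comp HM) comp_assoc (lax2_nat Hφ). Qed.

Lemma lax2_pull_l (A A' B U V : C) (f : A ~> A') (u : U ~> G A) (v : V ~> G B) :
  φ A' B ∘ ((fmap G f ∘ u) ⋆₁ v) = fmap G (f ⋆₁ idm B) ∘ φ A B ∘ (u ⋆₁ v).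
Proof. by rewrite -lax2_pull fmap_id comp_idl. Qed.

Lemma lax2_pull_r (A B B' U V : C) (g : B ~> B') (u : U ~> G A) (v : V ~> G B) :
  φ A B' ∘ (u ⋆₁ (fmap G g ∘ v)) = fmap G (idm A ⋆₁ g) ∘ φ A B ∘ (u ⋆₁ v).
Proof. by rewrite -lax2_pull fmap_id comp_idl. Qed.

Lemma ten_coalg_eps (A B : coalgebra G) :
  eps G (A ⋆ B) ∘ (φ A B ∘ (coalg_str A ⋆₁ coalg_str B)) = idm _.
Proof.
by rewrite comp_assoc (eps_lax2 Hφ) (tenm_merge HM) !coalg_eps (tenm_id HM).
Qed.

Lemma ten_coalg_delta (A B : coalgebra G) :
  delta G (A ⋆ B) ∘ (φ A B ∘ (coalg_str A ⋆₁ coalg_str B))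
  = fmap G (φ A B ∘ (coalg_str A ⋆₁ coalg_str B)) ∘ (φ A B ∘ (coalg_str A ⋆₁ coalg_str B)).
Proof.
rewrite comp_assoc (delta_lax2 Hφ) (tenm_merge_pre HM) !coalg_delta fmap_comp (tenm_comp HM).
by rewrite comp_assoc (comp_pre (lax2_nat Hφ _ _)) !comp_assoc.
Qed.

Definition ten_coalg (A B : coalgebra G) : coalgebra G :=
  Coalgebra (ten_coalg_eps A B) (ten_coalg_delta A B).
Definition unt_coalg : coalgebra G := Coalgebra (eps_lax0 Hφ) (delta_lax0 Hφ).

(** At cofree coalgebras with [f] and [g] the counits, [delta_epsr] collapses the right side to [φ];
    this is how [φ] is recovered from the lifted tensor. *)
Lemma ten_str_post (A B : coalgebra G) (A' B' : C) (f : A ~> A') (g : B ~> B') :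
  fmap G (f ⋆₁ g) ∘ coalg_str (ten_coalg A B)
  = φ A' B' ∘ ((fmap G f ∘ coalg_str A) ⋆₁ (fmap G g ∘ coalg_str B)).
Proof. by rewrite /= comp_assoc lax2_pull. Qed.

Lemma ten_map (A A' B B' : coalgebra G) (f : A ~> A') (g : B ~> B') :
  coalg_map f -> coalg_map g ->
  coalg_map (A := ten_coalg A B) (B := ten_coalg A' B') (f ⋆₁ g).
Proof.
rewrite /coalg_map /= => Hf Hg.
by rewrite comp_assoc -(lax2_nat Hφ) !(tenm_merge_pre HM, Hf, Hg).
Qed.

Lemma asc_map (A B D : coalgebra G) :
  coalg_map (A := ten_coalg (ten_coalg A B) D) (B := ten_coalg A (ten_coalg B D)) (asc M A B D).
Proof.
rewrite /coalg_map /= -{1}(comp_idl (coalg_str D)) (tenm_comp HM) !comp_assoc (lax_asc Hφ).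
rewrite -{2}(comp_idl (coalg_str A)) (tenm_comp HM) !comp_assoc.
by rewrite (comp_pre (asc_nat HM _ _ _)) !comp_assoc.
Qed.

Lemma asci_map (A B D : coalgebra G) :
  coalg_map (A := ten_coalg A (ten_coalg B D)) (B := ten_coalg (ten_coalg A B) D) (asci M A B D).
Proof. apply: (inv_map (A := ten_coalg (ten_coalg A B) D) (B := ten_coalg A (ten_coalg B D))).
- exact: (asci_asc HM).
- exact: (asc_asci HM).
- exact: asc_map. Qed.

Lemma lun_map (A : coalgebra G) : coalg_map (A := ten_coalg unt_coalg A) (lun M A).
Proof.
rewrite /coalg_map /= -(lun_nat HM) -(lax_lun Hφ) (tenm_merge_pre HM) comp_idr comp_idl.
by rewrite comp_assoc.
Qed.

Lemma run_map (A : coalgebra G) : coalg_map (A := ten_coalg A unt_coalg) (run M A).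
Proof.
rewrite /coalg_map /= -(run_nat HM) -(lax_run Hφ) (tenm_merge_pre HM) comp_idr comp_idl.
by rewrite comp_assoc.
Qed.

Lemma luni_map (A : coalgebra G) : coalg_map (B := ten_coalg unt_coalg A) (luni M A).
Proof. exact: (inv_map (A := ten_coalg unt_coalg A) (luni_lun HM A) (lun_luni HM A) (lun_map A)). Qed.

Lemma runi_map (A : coalgebra G) : coalg_map (B := ten_coalg A unt_coalg) (runi M A).
Proof. exact: (inv_map (A := ten_coalg A unt_coalg) (runi_run HM A) (run_runi HM A) (run_map A)). Qed.

End Tensor.

(** * Lifting of a contravariant functor to coalgebras *)

Section Contravariant.
Context (S : contrafunctor C) (ν : forall A : C, S A ~> G (S (G A))) (Hν : lifting ν).

Lemma con_coalg_eps (A : coalgebra G) :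
  eps G (S A) ∘ (fmap G (cmap S (coalg_str A)) ∘ ν A) = idm _.
Proof.
by rewrite comp_assoc eps_nat -comp_assoc (lifting_eps Hν) -cmap_comp coalg_eps cmap_id.
Qed.

(** Naturality of [ν] gathers everything into [fmap G f ∘ coalg_str A], which simplifies in each
    case of interest: [f] a coalgebra map, [f] the structure map itself, or [f] built from counits
    at cofree coalgebras. *)
Lemma con_str_comp (A : coalgebra G) (B : C) (f : A ~> B) :
  fmap G (cmap S (coalg_str A)) ∘ ν A ∘ cmap S f
  = fmap G (cmap S (fmap G f ∘ coalg_str A)) ∘ ν B.
Proof. by rewrite (comp_pre (lifting_nat Hν _)) comp_assoc fmap_cmap. Qed.

Lemma con_coalg_delta (A : coalgebra G) :
  delta G (S A) ∘ (fmap G (cmap S (coalg_str A)) ∘ ν A)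
  = fmap G (fmap G (cmap S (coalg_str A)) ∘ ν A) ∘ (fmap G (cmap S (coalg_str A)) ∘ ν A).
Proof.
rewrite !comp_assoc delta_nat (comp_pre (lifting_delta Hν _)) -(fmap_comp G (_ ∘ ν A)).
by rewrite con_str_comp -coalg_delta cmap_comp !fmap_comp !comp_assoc.
Qed.

Definition con_coalg (A : coalgebra G) : coalgebra G :=
  Coalgebra (con_coalg_eps A) (con_coalg_delta A).

Lemma con_map (A B : coalgebra G) (f : A ~> B) :
  coalg_map f -> coalg_map (A := con_coalg B) (B := con_coalg A) (cmap S f).
Proof.
by rewrite /coalg_map /= => Hf; rewrite con_str_comp Hf fmap_cmap !comp_assoc.
Qed.

(** The two counits cancel the comultiplications in the structure of a tensor of cofree coalgebras,
    leaving only [φ]. This produces the factors [cmap S (φ A B)] and [cmap S' (φ A B)] in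
    [sa_lift_ev] and [sa_lift_ev']. *)
Lemma con_ten_cofree (M : monoidal_ops C) (φ : lax_ops G M) (HM : is_monoidal M)
    (Hφ : monoidal_comonad φ) (A B : C) :
  coalg_str (con_coalg (ten_coalg HM Hφ (cofree A) (cofree B))) ∘ cmap S (tenm M (eps G A) (eps G B))
  = fmap G (cmap S (φ A B)) ∘ ν (ten M A B).
Proof.
rewrite (con_str_comp (A := ten_coalg HM Hφ (cofree A) (cofree B))).
by rewrite /= comp_assoc -(lax2_nat Hφ) (tenm_merge_pre HM) !delta_epsr (tenm_id HM) comp_idr.
Qed.

(** The way back from the lifted functor to [ν]: the counit law cancels [eps] against [delta]. *)
Lemma con_cofree (A : C) : coalg_str (con_coalg (cofree A)) ∘ cmap S (eps G A) = ν A.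
Proof. by have := con_str_comp (A := cofree A) (eps G A); rewrite /= delta_epsr cmap_id fmap_id comp_idl. Qed.

End Contravariant.
End Coalgebras.

(** * Zigzags in a linearly distributive category with negations *)

Section Ldn.
Context (C : category) (L : ldn_ops C) (HL : is_ldn L).
Local Notation "A ⋆ B" := (ten (star L) A B).
Local Notation "f ⋆₁ g" := (tenm (star L) f g).
Local Notation "A ◇ B" := (ten (par L) A B).
Local Notation "f ◇₁ g" := (tenm (par L) f g).
Local Notation I := (unt (star L)).
Local Notation J := (unt (par L)).
Local Notation S := (ldn_S L).
Local Notation S' := (ldn_S' L).
Let HM : is_monoidal (star L) := ldn_star HL.
Let HP : is_monoidal (par L) := ldn_par HL.
Let X := sa_of_ldn L.

(** This lemma and the next five give naturality of zigzags in the outer objects and dinaturality in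
    the cancelled one, [B] for [zigl] and [D] for [zigr]. With [zigl_zigr] they let later equations
    treat zigzags as black boxes. *)
Lemma zigl_pre (A A' B D : C) (x : I ~> B ◇ D) (y : A ⋆ B ~> J) (f : A' ~> A) :
  zigl x y ∘ f = zigl x (y ∘ (f ⋆₁ idm B)).
Proof.
rewrite /zigl (comp_pre (runi_nat HM f)) !comp_assoc (tenm_merge_pre HM).
rewrite comp_idr comp_idl -{1}(comp_idr f) -{1}(comp_idl x) (tenm_comp HM) -(tenm_id HP) comp_assoc.
rewrite (comp_pre (distl_nat HL _ _ _)) !comp_assoc.
by rewrite (tenm_merge_pre HP) comp_idl.
Qed.

Lemma zigl_post (A B D D' : C) (x : I ~> B ◇ D) (y : A ⋆ B ~> J) (d : D ~> D') :
  d ∘ zigl x y = zigl ((idm B ◇₁ d) ∘ x) y.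
Proof.
rewrite /zigl !comp_assoc -(lun_nat HP) (tenm_merge_pre HP).
rewrite (tenm_comp_r HM) comp_assoc (comp_pre (distl_nat HL _ _ _)) (tenm_id HM) comp_assoc.
by rewrite (tenm_merge_pre HP) !comp_idl !comp_idr.
Qed.

Lemma zigl_mid (A B B' D : C) (x : I ~> B ◇ D) (y : A ⋆ B' ~> J) (b : B ~> B') :
  zigl ((b ◇₁ idm D) ∘ x) y = zigl x (y ∘ (idm A ⋆₁ b)).
Proof.
rewrite /zigl (tenm_comp_r HM) comp_assoc (comp_pre (distl_nat HL _ _ _)) comp_assoc.
by rewrite (tenm_merge_pre HP) !comp_idl.
Qed.

Lemma zigr_pre (A A' B D : C) (x : I ~> B ◇ D) (y : D ⋆ A ~> J) (f : A' ~> A) :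
  zigr x y ∘ f = zigr x (y ∘ (idm D ⋆₁ f)).
Proof.
rewrite /zigr (comp_pre (luni_nat HM f)) !comp_assoc (tenm_merge_pre HM).
rewrite comp_idr comp_idl -{1}(comp_idr f) -{1}(comp_idl x) (tenm_comp HM) -(tenm_id HP) comp_assoc.
rewrite (comp_pre (distr_nat HL _ _ _)) !comp_assoc.
by rewrite (tenm_merge_pre HP) comp_idl.
Qed.

Lemma zigr_post (A B B' D : C) (x : I ~> B ◇ D) (y : D ⋆ A ~> J) (b : B ~> B') :
  b ∘ zigr x y = zigr ((b ◇₁ idm D) ∘ x) y.
Proof.
rewrite /zigr !comp_assoc -(run_nat HP) (tenm_merge_pre HP).
rewrite (tenm_comp_l HM) comp_assoc (comp_pre (distr_nat HL _ _ _)) (tenm_id HM) comp_assoc.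
by rewrite (tenm_merge_pre HP) !comp_idl !comp_idr.
Qed.

Lemma zigr_mid (A B D D' : C) (x : I ~> B ◇ D) (y : D' ⋆ A ~> J) (d : D ~> D') :
  zigr ((idm B ◇₁ d) ∘ x) y = zigr x (y ∘ (d ⋆₁ idm A)).
Proof.
rewrite /zigr (tenm_comp_l HM) comp_assoc (comp_pre (distr_nat HL _ _ _)) comp_assoc.
by rewrite (tenm_merge_pre HP) !comp_idl.
Qed.

(** Both sides equal
    [A ⋆ E -> A ⋆ (B ◇ D) ⋆ E -> (A ⋆ B) ◇ (D ⋆ E) -> J ◇ J -> J]. *)
Lemma zigl_zigr (A B D E : C) (x : I ~> B ◇ D) (y : A ⋆ B ~> J) (z : D ⋆ E ~> J) :
  z ∘ (zigl x y ⋆₁ idm E) = y ∘ (idm A ⋆₁ zigr x z).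
Proof.
have -> : z ∘ (zigl x y ⋆₁ idm E)
    = lun (par L) J ∘ (y ◇₁ z) ∘ distl L A B (D ⋆ E) ∘ (idm A ⋆₁ distr L B D E)
      ∘ (idm A ⋆₁ (x ⋆₁ idm E)) ∘ (idm A ⋆₁ luni (star L) E).
  rewrite /zigl !(tenm_comp_l HM) !comp_assoc.
  rewrite -(distr_unit_par HL) comp_assoc -(lun_nat HP).
  rewrite (comp_pre (distr_nat HL _ _ _)) (tenm_id HM) comp_assoc (tenm_merge_pre HP).
  rewrite comp_idl comp_idr (comp_pre (distl_distr_star HL _ _ _ _)) !comp_assoc.
  by rewrite (comp_pre (asc_nat HM _ _ _)) !comp_assoc (comp_pre (asc_runi HM _ _)).
(* [zigl] collapses [J ◇ J] by [lun] and [zigr] by [run]; the two agree at the unit. *)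
rewrite (lun_run_unt HP) /zigr !(tenm_comp_r HM) !comp_assoc.
rewrite -(distl_unit_par HL) comp_assoc -(run_nat HP).
rewrite (comp_pre (distl_nat HL _ _ _)) (tenm_id HM) comp_assoc (tenm_merge_pre HP).
by rewrite comp_idl comp_idr.
Qed.

(** [zigl_zigr] moves the inner zigzag to the other argument of the evaluation, where
    [ldn_triangle4] straightens it; what remains is [ldn_triangle2]. For [η] the two triangles are
    used in the opposite order. *)
Lemma kap_kapi_of_ldn (A : C) : sa_kap X A ∘ sa_kapi X A = idm _.
Proof.
by rewrite /= zigl_pre zigl_zigr (ldn_triangle4 HL) (tenm_id HM) comp_idr (ldn_triangle2 HL).
Qed.

Lemma eta_etai_of_ldn (A : C) : sa_eta X A ∘ sa_etai X A = idm _.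
Proof.
by rewrite /= zigr_pre -zigl_zigr (ldn_triangle2 HL) (tenm_id HM) comp_idr (ldn_triangle4 HL).
Qed.

Lemma kap_nat_of_ldn (A B : C) (f : A ~> B) :
  sa_kap X B ∘ f = cmap S (cmap S' f) ∘ sa_kap X A.
Proof.
by rewrite /= zigl_pre -(ldn_e'_dinat HL) -zigl_mid (ldn_n_dinat HL) -zigl_post.
Qed.

Lemma eta_nat_of_ldn (A B : C) (f : A ~> B) :
  sa_eta X B ∘ f = cmap S' (cmap S f) ∘ sa_eta X A.
Proof.
by rewrite /= zigr_pre -(ldn_e_dinat HL) -zigr_mid (ldn_n'_dinat HL) -zigr_post.
Qed.

(** Dinaturality of [n] accounts for [cmap S g] on the right, and dinaturality of [e] at [f ⋆₁ g]
    for the rest. *)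
Lemma ev_nat_of_ldn (A A' B B' : C) (f : A ~> A') (g : B ~> B') :
  sa_ev X A B ∘ (cmap S (f ⋆₁ g) ⋆₁ idm A)
  = cmap S g ∘ sa_ev X A' B' ∘ (idm (S (A' ⋆ B')) ⋆₁ f).
Proof.
rewrite /= zigl_pre zigl_post zigl_pre -(ldn_n_dinat HL) zigl_mid.
rewrite (comp_pre (asc_nat HM _ _ _)) (tenm_id HM) comp_assoc (ldn_e_dinat HL).
rewrite (tenm_merge_pre HM) comp_idl comp_idr (comp_pre (esym (asc_nat HM _ _ _))).
by rewrite comp_assoc.
Qed.

Lemma ev'_nat_of_ldn (A A' B B' : C) (f : A ~> A') (g : B ~> B') :
  sa_ev' X B A ∘ (idm B ⋆₁ cmap S' (f ⋆₁ g))
  = cmap S' f ∘ sa_ev' X B' A' ∘ (g ⋆₁ idm (S' (A' ⋆ B'))).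
Proof.
rewrite /= zigr_pre zigr_post zigr_pre -(ldn_n'_dinat HL) zigr_mid.
rewrite (comp_pre (asci_nat HM _ _ _)) (tenm_id HM) comp_assoc (ldn_e'_dinat HL).
rewrite (tenm_merge_pre HM) comp_idl comp_idr (comp_pre (esym (asci_nat HM _ _ _))).
by rewrite comp_assoc.
Qed.

(** * Structure maps lifted by an LDN-comonad *)

Section Lift.
Context (G : comonad C) (φ : lax_ops G (star L)) (ψ : lax_ops G (par L)).
Context (ν : forall A : C, S A ~> G (S (G A))) (ν' : forall A : C, S' A ~> G (S' (G A))).
Context (HG : ldn_comonad φ ψ ν ν').
Let Hφ := ldn_lax_star HG.
Let Hψ := ldn_lax_par HG.
Let Hν := ldn_lift HG.
Let Hν' := ldn_lift' HG.
Local Notation sten := (ten_coalg HM Hφ).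
Local Notation pten := (ten_coalg HP Hψ).
Local Notation Iᴳ := (unt_coalg Hφ).
Local Notation Jᴳ := (unt_coalg Hψ).
Local Notation Sᴳ := (con_coalg Hν).
Local Notation S'ᴳ := (con_coalg Hν').

Lemma distl_map (A B D : coalgebra G) :
  coalg_map (A := sten A (pten B D)) (B := pten (sten A B) D) (distl L A B D).
Proof.
rewrite /coalg_map /= -{1}(comp_idl (coalg_str A)) (tenm_comp HM) !comp_assoc (ldn_distl HG).
rewrite (comp_pre (distl_nat HL _ _ _)) comp_assoc (tenm_merge_pre HP).
by rewrite comp_idl.
Qed.

Lemma distr_map (A B D : coalgebra G) :
  coalg_map (A := sten (pten B D) A) (B := pten B (sten D A)) (distr L B D A).
Proof.
rewrite /coalg_map /= -{1}(comp_idl (coalg_str A)) (tenm_comp HM) !comp_assoc (ldn_distr HG).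
rewrite (comp_pre (distr_nat HL _ _ _)) comp_assoc (tenm_merge_pre HP).
by rewrite comp_idl.
Qed.

(** Dinaturality of [e] moves the structure map from [S A] to the factor [A], where the two copies
    combine to [delta] after [coalg_str A]. Then [ldn_lift_e] applies, and its counit cancels the
    remaining structure map. *)
Lemma e_map (A : coalgebra G) : coalg_map (A := sten (Sᴳ A) A) (B := Jᴳ) (ldn_e L A).
Proof.
rewrite /coalg_map /= (lax2_pull_l HM Hφ) !comp_assoc -fmap_comp (ldn_e_dinat HL) fmap_comp.
rewrite -!comp_assoc [fmap G (_ ⋆₁ _) ∘ _]comp_assoc -(lax2_pull_r HM Hφ) -coalg_delta.
rewrite -{1}(comp_idr (ν A)) (tenm_comp HM) !comp_assoc -(ldn_lift_e HG) (tenm_merge_pre HM).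
by rewrite coalg_eps comp_idl (tenm_id HM) comp_idr.
Qed.

Lemma e'_map (A : coalgebra G) : coalg_map (A := sten A (S'ᴳ A)) (B := Jᴳ) (ldn_e' L A).
Proof.
rewrite /coalg_map /= (lax2_pull_r HM Hφ) !comp_assoc -fmap_comp (ldn_e'_dinat HL) fmap_comp.
rewrite -!comp_assoc [fmap G (_ ⋆₁ _) ∘ _]comp_assoc -(lax2_pull_l HM Hφ) -coalg_delta.
rewrite -{1}(comp_idr (ν' A)) (tenm_comp HM) !comp_assoc -(ldn_lift_e' HG) (tenm_merge_pre HM).
by rewrite coalg_eps comp_idl (tenm_id HM) comp_idr.
Qed.

Lemma n_map (A : coalgebra G) : coalg_map (A := Iᴳ) (B := pten A (Sᴳ A)) (ldn_n L A).
Proof.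
(* Applying [S] of the structure map cancels [eps] on the left and replaces [delta] by a second copy
   of the structure map on the right. Naturality of [ν] and dinaturality of [n] then carry one of
   the two copies over to the first factor of [◇]. *)
have := f_equal (comp (fmap G (idm A ◇₁ cmap S (coalg_str A)))) (ldn_lift_n HG A).
rewrite /coalg_map /= !comp_assoc -!fmap_comp !(tenm_merge HP) -!cmap_comp coalg_eps coalg_delta.
rewrite cmap_id !comp_idl (tenm_id HP) comp_idl => ->.
rewrite -(lax2_pull_r HP Hψ) fmap_cmap -[_ ∘ ν _]comp_assoc -(lifting_nat Hν) comp_assoc.
rewrite (tenm_comp_r HP) comp_assoc (comp_pre (esym (ldn_n_dinat HL _))) comp_assoc.
by rewrite (tenm_merge_pre HP) comp_idl comp_idr.
Qed.

Lemma n'_map (A : coalgebra G) : coalg_map (A := Iᴳ) (B := pten (S'ᴳ A) A) (ldn_n' L A).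
Proof.
have := f_equal (comp (fmap G (cmap S' (coalg_str A) ◇₁ idm A))) (ldn_lift_n' HG A).
rewrite /coalg_map /= !comp_assoc -!fmap_comp !(tenm_merge HP) -!cmap_comp coalg_eps coalg_delta.
rewrite cmap_id !comp_idl (tenm_id HP) comp_idl => ->.
rewrite -(lax2_pull_l HP Hψ) fmap_cmap -[_ ∘ ν' _]comp_assoc -(lifting_nat Hν') comp_assoc.
rewrite (tenm_comp_l HP) comp_assoc (comp_pre (esym (ldn_n'_dinat HL _))) comp_assoc.
by rewrite (tenm_merge_pre HP) comp_idl comp_idr.
Qed.

Lemma zigl_map (A B D : coalgebra G) (x : I ~> B ◇ D) (y : A ⋆ B ~> J) :
  coalg_map (A := Iᴳ) (B := pten B D) x -> coalg_map (A := sten A B) (B := Jᴳ) y ->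
  coalg_map (zigl x y).
Proof.
move=> Hx Hy; apply: (comp_map _ (runi_map HM Hφ A)).
apply: (comp_map _ (ten_map HM Hφ (id_map A) Hx)).
apply: (comp_map _ (distl_map A B D)).
exact: (comp_map (lun_map HP Hψ D) (ten_map HP Hψ Hy (id_map D))).
Qed.

Lemma zigr_map (A B D : coalgebra G) (x : I ~> B ◇ D) (y : D ⋆ A ~> J) :
  coalg_map (A := Iᴳ) (B := pten B D) x -> coalg_map (A := sten D A) (B := Jᴳ) y ->
  coalg_map (zigr x y).
Proof.
move=> Hx Hy; apply: (comp_map _ (luni_map HM Hφ A)).
apply: (comp_map _ (ten_map HM Hφ Hx (id_map A))).
apply: (comp_map _ (distr_map A B D)).
exact: (comp_map (run_map HP Hψ B) (ten_map HP Hψ (id_map B) Hy)).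
Qed.

Lemma kap_map (A : coalgebra G) : coalg_map (B := Sᴳ (S'ᴳ A)) (sa_kap X A).
Proof. exact: zigl_map (n_map (S'ᴳ A)) (e'_map A). Qed.

Lemma eta_map (A : coalgebra G) : coalg_map (B := S'ᴳ (Sᴳ A)) (sa_eta X A).
Proof. exact: zigr_map (n'_map (Sᴳ A)) (e_map A). Qed.

Lemma ev_map (A B : coalgebra G) :
  coalg_map (A := sten (Sᴳ (sten A B)) A) (B := Sᴳ B) (sa_ev X A B).
Proof.
exact: (zigl_map (A := sten _ A) (n_map B) (comp_map (e_map (sten A B)) (asc_map HM Hφ _ A B))).
Qed.

Lemma ev'_map (A B : coalgebra G) :
  coalg_map (A := sten B (S'ᴳ (sten A B))) (B := S'ᴳ A) (sa_ev' X B A).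
Proof.
exact: (zigr_map (A := sten B _) (n'_map A) (comp_map (e'_map (sten A B)) (asci_map HM Hφ A B _))).
Qed.

Theorem sa_comonad_of_ldn : sa_comonad (X := X) φ ν ν'.
Proof.
split=> //.
- move=> A.
  (* By naturality of [κ] the counit cancels [delta] on the left and leaves [fmap G (sa_kap X A)];
     on the right [con_cofree] turns it into [ν']. Precomposing with [κi] gives the condition. *)
  have := f_equal (comp (fmap G (cmap S (cmap S' (eps G A))))) (kap_map (cofree G A)).
  rewrite /coalg_map comp_assoc -fmap_comp -kap_nat_of_ldn fmap_comp -comp_assoc delta_epsr comp_idr.
  move=> ->; rewrite (comp_assoc _ _ (sa_kap X _)) (comp_assoc _ (fmap G _)) -fmap_cmap (con_cofree Hν').
  by rewrite (comp_pre (kap_kapi_of_ldn (G A))) comp_idr.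
- move=> A.
  have := f_equal (comp (fmap G (cmap S' (cmap S (eps G A))))) (eta_map (cofree G A)).
  rewrite /coalg_map comp_assoc -fmap_comp -eta_nat_of_ldn fmap_comp -comp_assoc delta_epsr comp_idr.
  move=> ->; rewrite (comp_assoc _ _ (sa_eta X _)) (comp_assoc _ (fmap G _)) -fmap_cmap (con_cofree Hν).
  by rewrite (comp_pre (eta_etai_of_ldn (G A))) comp_idr.
- move=> A B.
  (* Writing [ν B] as a cofree structure map after [cmap S (eps G B)] lets naturality of [ev] merge
     both counits into [cmap S (eps ⋆₁ eps)]. The lifted [ev] at cofree coalgebras then applies, and
     [con_ten_cofree] absorbs the counits. *)
  rewrite -(con_cofree Hν) -[_ ∘ _ ∘ sa_ev X A B]comp_assoc -comp_assoc -ev_nat_of_ldn comp_assoc.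
  rewrite -(ev_map (cofree G A) (cofree G B)).
  have := con_ten_cofree Hν HM Hφ A B; rewrite /= => E.
  by rewrite comp_assoc (tenm_merge_pre HM) E comp_idr -[LHS]comp_assoc (lax2_pull_l HM Hφ) !comp_assoc.
- move=> A B.
  rewrite -(con_cofree Hν') -[_ ∘ _ ∘ sa_ev' X B A]comp_assoc -comp_assoc -ev'_nat_of_ldn comp_assoc.
  rewrite -(ev'_map (cofree G A) (cofree G B)).
  have := con_ten_cofree Hν' HM Hφ A B; rewrite /= => E.
  by rewrite comp_assoc (tenm_merge_pre HM) E comp_idr -[LHS]comp_assoc (lax2_pull_r HM Hφ) !comp_assoc.
Qed.

End Lift.
End Ldn.

(** * Evaluations in a star-autonomous category *)

Section Sa.
Context (C : category) (X : sa_ops C) (HX : is_star_autonomous X).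
Local Notation M := (sa_ten X).
Local Notation "A ⋆ B" := (ten M A B).
Local Notation "f ⋆₁ g" := (tenm M f g).
Local Notation I := (unt M).
Local Notation S := (sa_S X).
Local Notation S' := (sa_S' X).
Local Notation η := (sa_eta X).
Local Notation ηi := (sa_etai X).
Local Notation κ := (sa_kap X).
Local Notation κi := (sa_kapi X).
Local Notation ev := (sa_ev X).
Local Notation ev' := (sa_ev' X).
Local Notation P := (par_of_sa X).
Local Notation "A ◇ B" := (ten P A B).
Local Notation "f ◇₁ g" := (tenm P f g).
Let HM : is_monoidal M := sa_monoidal HX.

Lemma etai_nat (A B : C) (f : A ~> B) : ηi B ∘ cmap S' (cmap S f) = f ∘ ηi A.
Proof. exact: inverse_nat (sa_eta_etai HX A) (sa_etai_eta HX B) (sa_eta_nat HX f). Qed.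

Lemma kapi_nat (A B : C) (f : A ~> B) : κi B ∘ cmap S (cmap S' f) = f ∘ κi A.
Proof. exact: inverse_nat (sa_kap_kapi HX A) (sa_kapi_kap HX B) (sa_kap_nat HX f). Qed.

Section HomIso.
Context (h : sa_hom_iso X).

Lemma unc_nat1 (A A' B D : C) (a : A ~> A') (g : A' ~> S (B ⋆ D)) :
  unc h (g ∘ a) = unc h g ∘ (a ⋆₁ idm B).
Proof. by rewrite -[RHS](unc_cur h) (cur_nat1 h) (cur_unc h). Qed.

Lemma unc_nat2 (A B B' D : C) (b : B ~> B') (g : A ~> S (B' ⋆ D)) :
  unc h (cmap S (b ⋆₁ idm D) ∘ g) = unc h g ∘ (idm A ⋆₁ b).
Proof. by rewrite -[RHS](unc_cur h) (cur_nat2 h) (cur_unc h). Qed.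

Lemma unc_nat3 (A B D D' : C) (d : D ~> D') (g : A ~> S (B ⋆ D')) :
  unc h (cmap S (idm B ⋆₁ d) ∘ g) = cmap S d ∘ unc h g.
Proof. by rewrite -[RHS](unc_cur h) (cur_nat3 h) (cur_unc h). Qed.

End HomIso.

(** Since [ev] transposes an identity, naturality of transposition in its three variables makes both
    sides the transpose of [cmap S (f ⋆₁ g)]. *)
Lemma ev_nat (A A' B B' : C) (f : A ~> A') (g : B ~> B') :
  ev A B ∘ (cmap S (f ⋆₁ g) ⋆₁ idm A) = cmap S g ∘ ev A' B' ∘ (idm (S (A' ⋆ B')) ⋆₁ f).
Proof.
have [h [E _]] := sa_hom HX; rewrite !E -unc_nat1 -unc_nat3 -unc_nat2 comp_idl comp_idr.
by rewrite -cmap_comp (tenm_merge HM) comp_idl comp_idr.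
Qed.

Lemma ev'_nat (A A' B B' : C) (f : A ~> A') (g : B ~> B') :
  ev' B A ∘ (idm B ⋆₁ cmap S' (f ⋆₁ g)) = cmap S' f ∘ ev' B' A' ∘ (g ⋆₁ idm (S' (A' ⋆ B'))).
Proof.
have [h [_ E]] := sa_hom HX; rewrite !E -[LHS]comp_assoc (sa_eta_nat HX) -!comp_assoc (sa_eta_nat HX).
rewrite !comp_assoc -!cmap_comp -(cur_nat3 h) -(sa_kap_nat HX) -(cur_nat1 h) -(cur_nat2 h).
by rewrite -comp_assoc (tenm_merge HM) comp_idl comp_idr.
Qed.

Lemma ev_nat_l (A A' B : C) (f : A ~> A') :
  ev A B ∘ (cmap S (f ⋆₁ idm B) ⋆₁ idm A) = ev A' B ∘ (idm _ ⋆₁ f).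
Proof. by rewrite ev_nat cmap_id comp_idl. Qed.

Lemma ev_nat_r (A B B' : C) (g : B ~> B') :
  ev A B ∘ (cmap S (idm A ⋆₁ g) ⋆₁ idm A) = cmap S g ∘ ev A B'.
Proof. by rewrite ev_nat (tenm_id HM) comp_idr. Qed.

Lemma ev'_nat_l (A A' B : C) (f : A ~> A') :
  ev' B A ∘ (idm B ⋆₁ cmap S' (f ⋆₁ idm B)) = cmap S' f ∘ ev' B A'.
Proof. by rewrite ev'_nat (tenm_id HM) comp_idr. Qed.

Lemma ev'_nat_r (A B B' : C) (g : B ~> B') :
  ev' B A ∘ (idm B ⋆₁ cmap S' (idm A ⋆₁ g)) = ev' B' A ∘ (g ⋆₁ idm _).
Proof. by rewrite ev'_nat cmap_id comp_idl. Qed.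

(** Working forms of [ev_nat] and [ev'_nat] for nested evaluations: the slide lemmas trade a map on
    the argument for one on the functional, the pull lemmas take a map on the result outside. *)
Lemma ev_slide (A A' B E : C) (x : A ~> A') (k : E ~> S (A' ⋆ B)) :
  ev A' B ∘ (k ⋆₁ x) = ev A B ∘ ((cmap S (x ⋆₁ idm B) ∘ k) ⋆₁ idm A).
Proof. by rewrite (tenm_comp_l HM) comp_assoc ev_nat_l (tenm_merge_pre HM) comp_idl comp_idr. Qed.

Lemma ev'_slide (A B B' E : C) (x : B ~> B') (k : E ~> S' (A ⋆ B')) :
  ev' B' A ∘ (x ⋆₁ k) = ev' B A ∘ (idm B ⋆₁ (cmap S' (idm A ⋆₁ x) ∘ k)).
Proof. by rewrite (tenm_comp_r HM) comp_assoc ev'_nat_r (tenm_merge_pre HM) comp_idl comp_idr. Qed.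

Lemma ev_pull (A B B' E : C) (g : B ~> B') (k : E ~> S (A ⋆ B')) :
  ev A B ∘ ((cmap S (idm A ⋆₁ g) ∘ k) ⋆₁ idm A) = cmap S g ∘ ev A B' ∘ (k ⋆₁ idm A).
Proof. by rewrite (tenm_comp_l HM) comp_assoc ev_nat_r. Qed.

Lemma ev'_pull (A A' B E : C) (f : A ~> A') (k : E ~> S' (A' ⋆ B)) :
  ev' B A ∘ (idm B ⋆₁ (cmap S' (f ⋆₁ idm B) ∘ k)) = cmap S' f ∘ ev' B A' ∘ (idm B ⋆₁ k).
Proof. by rewrite (tenm_comp_r HM) comp_assoc ev'_nat_l. Qed.

(** * Naturality of the derived linearly distributive structure *)

Lemma par_id (A B : C) : idm A ◇₁ idm B = idm (A ◇ B).
Proof. by rewrite /= !cmap_id (tenm_id HM) cmap_id. Qed.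

Lemma par_comp (A A' A'' B B' B'' : C) (f' : A' ~> A'') (f : A ~> A')
    (g' : B' ~> B'') (g : B ~> B') :
  (f' ∘ f) ◇₁ (g' ∘ g) = (f' ◇₁ g') ∘ (f ◇₁ g).
Proof. by rewrite /= -cmap_comp (tenm_merge HM) -!cmap_comp. Qed.

(** This and the naturality statements below serve to slide counits past the derived structure maps,
    when coalgebra maps at cofree coalgebras are turned into conditions on [ψ]. *)
Lemma par_asc_nat (A A' B B' D D' : C) (f : A ~> A') (g : B ~> B') (h : D ~> D') :
  asc P A' B' D' ∘ ((f ◇₁ g) ◇₁ h) = (f ◇₁ (g ◇₁ h)) ∘ asc P A B D.
Proof.
rewrite /= -!cmap_comp; congr (cmap S' _).
rewrite !comp_assoc (tenm_merge HM) comp_idr -(sa_kap_nat HX) -{1}(comp_idl (cmap S h)) (tenm_comp HM).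
rewrite (comp_pre (esym (asc_nat HM _ _ _))) comp_assoc !(tenm_merge_pre HM).
by rewrite comp_idl comp_idr kapi_nat.
Qed.

Lemma par_lun_nat (A A' : C) (f : A ~> A') :
  lun P A' ∘ (idm (S I) ◇₁ f) = f ∘ lun P A.
Proof.
rewrite /= !comp_assoc -(etai_nat f) -!comp_assoc; congr (_ ∘ _); rewrite -!cmap_comp.
congr (cmap S' _); rewrite (tenm_merge HM) cmap_id comp_idl comp_idr.
by rewrite (comp_pre (runi_nat HM _)) comp_assoc (tenm_merge HM) comp_idl comp_idr.
Qed.

Lemma par_run_nat (A A' : C) (f : A ~> A') :
  run P A' ∘ (f ◇₁ idm (S I)) = f ∘ run P A.
Proof.
rewrite /= !comp_assoc -(etai_nat f) -!comp_assoc; congr (_ ∘ _); rewrite -!cmap_comp.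
congr (cmap S' _); rewrite (tenm_merge HM) cmap_id comp_idl comp_idr.
by rewrite (comp_pre (luni_nat HM _)) comp_assoc (tenm_merge HM) comp_idl comp_idr.
Qed.

(** The evaluation that cancels [A] on the left; it is the factor under [cmap S'] in [par_ev_r],
    named so that [par_ev_r] becomes a nest of two evaluations. *)
Definition par_ev (A B : C) : S A ⋆ (A ◇ B) ~> B := ηi B ∘ ev' (S A) (S B).

Lemma par_ev_nat (A A' B B' : C) (f : A ~> A') (g : B ~> B') :
  par_ev A' B' ∘ (idm (S A') ⋆₁ (f ◇₁ g)) = g ∘ par_ev A B ∘ (cmap S f ⋆₁ idm (A ◇ B)).
Proof. by rewrite /par_ev (comp_pre (ev'_nat _ _)) !comp_assoc etai_nat. Qed.

(** Nested evaluations are handled from outside in: slide a map into the functional, use naturality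
    of the inner evaluation there, and pull the result out. The same pattern serves [par_swap],
    [par_swapi] and the distributions. *)
Lemma par_ev_r_nat (A A' B B' : C) (f : A ~> A') (g : B ~> B') :
  par_ev_r X A' B' ∘ ((f ◇₁ g) ⋆₁ idm (S' B')) = f ∘ par_ev_r X A B ∘ (idm (A ◇ B) ⋆₁ cmap S' g).
Proof.
rewrite /par_ev_r -/(par_ev A' B') -/(par_ev A B) (tenm_merge_pre HM) comp_idl comp_idr.
rewrite (comp_pre (ev'_slide _ _)) -cmap_comp par_ev_nat cmap_comp ev'_pull !comp_assoc etai_nat.
by rewrite (tenm_merge_pre HM) comp_idl -(cmap_comp S') /par_ev comp_assoc.
Qed.

Lemma par_swap_nat (A A' B B' : C) (f : A ~> A') (g : B ~> B') :
  par_swap X A' B' ∘ (f ◇₁ g) = cmap S (cmap S' g ⋆₁ cmap S' f) ∘ par_swap X A B.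
Proof.
rewrite /par_swap (comp_pre (sa_kap_nat HX _)) !comp_assoc; congr (_ ∘ _).
rewrite -!cmap_comp; congr (cmap S _).
rewrite comp_assoc -ev'_pull -(cmap_comp S') par_ev_r_nat (tenm_merge HM) comp_idl.
by rewrite (ev'_slide (cmap S' g)) -!(cmap_comp S').
Qed.

Lemma par_ev_l_nat (A A' B B' : C) (f : A ~> A') (g : B ~> B') :
  par_ev_l X A' B' ∘ (idm (S A') ⋆₁ cmap S (cmap S' g ⋆₁ cmap S' f))
  = g ∘ par_ev_l X A B ∘ (cmap S f ⋆₁ idm _).
Proof.
(* Naturality of the inner evaluation [S (S' B ⋆ S' A) ⋆ S' B ~> A], in the role that [par_ev_nat]
   plays for [par_ev_r]. *)
have E : κi A' ∘ ev (S' B') (S' A') ∘ (cmap S (cmap S' g ⋆₁ cmap S' f) ⋆₁ idm _)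
    = f ∘ (κi A ∘ ev (S' B) (S' A)) ∘ (idm _ ⋆₁ cmap S' g).
  by rewrite (comp_pre (ev_nat _ _)) !comp_assoc kapi_nat.
rewrite /par_ev_l (tenm_merge_pre HM) comp_idl comp_idr (comp_pre (ev_slide _ _)).
rewrite -cmap_comp E (cmap_comp S) ev_pull !comp_assoc kapi_nat.
by rewrite (tenm_merge_pre HM) comp_idl -(cmap_comp S) comp_assoc.
Qed.

Lemma par_swapi_nat (A A' B B' : C) (f : A ~> A') (g : B ~> B') :
  par_swapi X A' B' ∘ cmap S (cmap S' g ⋆₁ cmap S' f) = (f ◇₁ g) ∘ par_swapi X A B.
Proof.
rewrite /par_swapi -[LHS]comp_assoc (sa_eta_nat HX) !comp_assoc; congr (_ ∘ _).
rewrite -!(cmap_comp S'); congr (cmap S' _).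
rewrite comp_assoc -ev_pull -(cmap_comp S) par_ev_l_nat (tenm_merge_pre HM) comp_idl.
by rewrite (ev_slide (cmap S f)) -!(cmap_comp S).
Qed.

Lemma distl_of_sa_nat (A A' B B' D D' : C) (f : A ~> A') (g : B ~> B') (h : D ~> D') :
  distl_of_sa X A' B' D' ∘ (f ⋆₁ (g ◇₁ h)) = ((f ⋆₁ g) ◇₁ h) ∘ distl_of_sa X A B D.
Proof.
rewrite /distl_of_sa -!(cmap_comp S') [RHS]comp_assoc -ev'_pull (tenm_merge_pre HM) comp_idl.
rewrite (ev'_slide f) -!(cmap_comp S') (comp_pre (asc_nat HM _ _ _)) !comp_assoc.
rewrite [in RHS](tenm_merge HM) ev_nat -(tenm_id HM (S D')) [in LHS](comp_pre (asc_nat HM _ _ _)).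
by rewrite comp_assoc !(tenm_merge HM) comp_idl !comp_idr.
Qed.

Lemma distr_of_sa_nat (A A' B B' D D' : C) (f : A ~> A') (g : B ~> B') (h : D ~> D') :
  distr_of_sa X B' D' A' ∘ ((g ◇₁ h) ⋆₁ f) = (g ◇₁ (h ⋆₁ f)) ∘ distr_of_sa X B D A.
Proof.
rewrite /distr_of_sa (tenm_merge_pre HM) comp_idl par_swap_nat -!(cmap_comp S); move: (par_swap X B D) => s.
rewrite 3!(comp_assoc (g ◇₁ (h ⋆₁ f))) -par_swapi_nat -!(comp_assoc (par_swapi _ _ _)); congr (_ ∘ _).
rewrite !(tenm_merge_pre HM).
rewrite comp_idl comp_idr (ev_slide f) -ev_pull !(comp_assoc _ _ s) -!(cmap_comp S).
rewrite (comp_pre (asci_nat HM _ _ _)) -(tenm_id HM) (comp_pre (comp_pre (asci_nat HM _ _ _) _)).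
rewrite !comp_assoc !(tenm_merge HM).
by rewrite ev'_nat comp_idl !comp_idr.
Qed.

Lemma ev_unit_dinat (A B : C) (f : A ~> B) :
  ev_unit X A ∘ (cmap S f ⋆₁ idm A) = ev_unit X B ∘ (idm (S B) ⋆₁ f).
Proof.
rewrite /ev_unit !(tenm_merge_pre HM) -(cmap_comp S) -(run_nat HM) comp_idl comp_idr cmap_comp.
by rewrite -ev_slide comp_idl.
Qed.

Lemma ev'_unit_dinat (A B : C) (f : A ~> B) :
  ev'_unit X A ∘ (idm A ⋆₁ cmap S' f) = ev'_unit X B ∘ (f ⋆₁ idm (S' B)).
Proof.
rewrite /ev'_unit !(tenm_merge_pre HM) -(cmap_comp S') -(lun_nat HM) comp_idl comp_idr cmap_comp.
by rewrite -ev'_slide comp_idl.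
Qed.

Lemma e'_of_sa_dinat (A B : C) (f : A ~> B) :
  ldn_e' (ldn_of_sa X) A ∘ (idm A ⋆₁ cmap S' f) = ldn_e' (ldn_of_sa X) B ∘ (f ⋆₁ idm (S' B)).
Proof. by rewrite /= -!(comp_assoc (unit_iso X)) ev'_unit_dinat. Qed.

Lemma n_of_sa_dinat (A B : C) (f : A ~> B) :
  (f ◇₁ idm (S A)) ∘ ldn_n (ldn_of_sa X) A = (idm B ◇₁ cmap S f) ∘ ldn_n (ldn_of_sa X) B.
Proof.
rewrite /ldn_n /ldn_of_sa.
rewrite 3!(comp_assoc (_ ◇₁ _)) 3!(comp_assoc (idm B ◇₁ _)) -!par_swapi_nat.
rewrite -!(comp_assoc (par_swapi _ _ _)); congr (_ ∘ _).
rewrite -!(cmap_comp S) !(tenm_merge HM) !cmap_id !comp_idl !comp_idr etai_nat.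
rewrite -{1}(comp_idl (ηi A)) -{1}(comp_idr (cmap S' f)) (tenm_comp HM).
by rewrite (comp_assoc (ev'_unit X A)) ev'_unit_dinat (tenm_merge_pre HM) comp_idl.
Qed.

Lemma n'_of_sa_dinat (A B : C) (f : A ~> B) :
  (idm (S' A) ◇₁ f) ∘ ldn_n' (ldn_of_sa X) A = (cmap S' f ◇₁ idm B) ∘ ldn_n' (ldn_of_sa X) B.
Proof.
rewrite /ldn_n' /ldn_of_sa /=.
rewrite 2!(comp_assoc (cmap S' (cmap S f ⋆₁ _))) 2!(comp_assoc (cmap S' (cmap S (idm B) ⋆₁ _))).
rewrite -!(cmap_comp S') !(tenm_merge HM) !cmap_id !comp_idl !comp_idr.
rewrite kapi_nat -{1}(comp_idl (κi A)) -{1}(comp_idr (cmap S f)) (tenm_comp HM).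
by rewrite (comp_assoc (ev_unit X A)) ev_unit_dinat (tenm_merge_pre HM) comp_idl.
Qed.

(** * Structure maps lifted by a star-autonomous comonad *)

Section Lift.
Context (G : comonad C) (φ : lax_ops G M).
Context (ν : forall A : C, S A ~> G (S (G A))) (ν' : forall A : C, S' A ~> G (S' (G A))).
Context (HG : sa_comonad φ ν ν').
Let Hφ := sa_lax HG.
Let Hν := sa_lift HG.
Let Hν' := sa_lift' HG.
Local Notation sten := (ten_coalg HM Hφ).
Local Notation Iᴳ := (unt_coalg Hφ).
Local Notation Sᴳ := (con_coalg Hν).
Local Notation S'ᴳ := (con_coalg Hν').
Local Notation pten A B := (S'ᴳ (sten (Sᴳ B) (Sᴳ A))).
Local Notation Jᴳ := (Sᴳ Iᴳ).

(** Naturality of [ν] brings the structure map to the right as [cmap S (cmap S' _)]. After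
    [sa_lift_kap] it passes through [κi] by naturality, and [κi] cancels [κ]. *)
Lemma sa_kap_map (A : coalgebra G) : coalg_map (B := Sᴳ (S'ᴳ A)) (κ A).
Proof.
rewrite /coalg_map /= fmap_cmap.
rewrite -[fmap G (cmap S (ν' A)) ∘ _ ∘ _]comp_assoc -(lifting_nat Hν) comp_assoc (sa_lift_kap HG).
rewrite (comp_pre (kapi_nat _)) comp_assoc -[RHS]comp_assoc.
by rewrite (sa_kapi_kap HX) comp_idr.
Qed.

Lemma sa_eta_map (A : coalgebra G) : coalg_map (B := S'ᴳ (Sᴳ A)) (η A).
Proof.
rewrite /coalg_map /= fmap_cmap.
rewrite -[fmap G (cmap S' (ν A)) ∘ _ ∘ _]comp_assoc -(lifting_nat Hν') comp_assoc (sa_lift_eta HG).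
rewrite (comp_pre (etai_nat _)) comp_assoc -[RHS]comp_assoc.
by rewrite (sa_etai_eta HX) comp_idr.
Qed.

Lemma sa_kapi_map (A : coalgebra G) : coalg_map (A := Sᴳ (S'ᴳ A)) (κi A).
Proof.
exact: (inv_map (B := Sᴳ (S'ᴳ A)) (sa_kapi_kap HX A) (sa_kap_kapi HX A) (sa_kap_map A)).
Qed.

Lemma sa_etai_map (A : coalgebra G) : coalg_map (A := S'ᴳ (Sᴳ A)) (ηi A).
Proof.
exact: (inv_map (B := S'ᴳ (Sᴳ A)) (sa_etai_eta HX A) (sa_eta_etai HX A) (sa_eta_map A)).
Qed.

(** The equation [E] isolates the factor that occurs in [sa_lift_ev]. As in [e_map], two copies of
    the structure map of [A] produce [delta], and the counit in [sa_lift_ev] cancels the copy that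
    is left. *)
Lemma sa_ev_map (A B : coalgebra G) :
  coalg_map (A := sten (Sᴳ (sten A B)) A) (B := Sᴳ B) (ev A B).
Proof.
have E : ev A B ∘ (cmap S (φ A B ∘ (coalg_str A ⋆₁ coalg_str B)) ⋆₁ idm A)
    = cmap S (coalg_str B) ∘ (ev (G A) (G B) ∘ (cmap S (φ A B) ⋆₁ idm (G A))) ∘ (idm _ ⋆₁ coalg_str A).
  rewrite (cmap_comp S) (tenm_comp_l HM) comp_assoc ev_nat !comp_assoc.
  by rewrite !(tenm_merge_pre HM) !comp_idl !comp_idr.
rewrite /coalg_map /= (lax2_pull_l HM Hφ) !comp_assoc -fmap_comp E !fmap_comp.
rewrite -!comp_assoc [fmap G (idm _ ⋆₁ _) ∘ _]comp_assoc -(lax2_pull_r HM Hφ) -coalg_delta.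
rewrite -{1}(comp_idr (ν _)) (tenm_comp HM).
have := f_equal (fun k => fmap G (cmap S (coalg_str B)) ∘ (k ∘ (idm _ ⋆₁ coalg_str A))) (sa_lift_ev HG A B).
rewrite /= -!comp_assoc => <-.
by rewrite (tenm_merge HM) coalg_eps comp_idl (tenm_id HM) comp_idr.
Qed.

Lemma sa_ev'_map (A B : coalgebra G) :
  coalg_map (A := sten B (S'ᴳ (sten A B))) (B := S'ᴳ A) (ev' B A).
Proof.
have E : ev' B A ∘ (idm B ⋆₁ cmap S' (φ A B ∘ (coalg_str A ⋆₁ coalg_str B)))
    = cmap S' (coalg_str A) ∘ (ev' (G B) (G A) ∘ (idm (G B) ⋆₁ cmap S' (φ A B))) ∘ (coalg_str B ⋆₁ idm _).
  rewrite (cmap_comp S') (tenm_comp_r HM) comp_assoc ev'_nat !comp_assoc.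
  by rewrite !(tenm_merge_pre HM) !comp_idl !comp_idr.
rewrite /coalg_map /= (lax2_pull_r HM Hφ) !comp_assoc -fmap_comp E !fmap_comp.
rewrite -!comp_assoc [fmap G (_ ⋆₁ idm _) ∘ _]comp_assoc -(lax2_pull_l HM Hφ) -coalg_delta.
rewrite -{1}(comp_idr (ν' _)) (tenm_comp HM).
have := f_equal (fun k => fmap G (cmap S' (coalg_str A)) ∘ (k ∘ (coalg_str B ⋆₁ idm _))) (sa_lift_ev' HG A B).
rewrite /= -!comp_assoc => <-.
by rewrite (tenm_merge HM) coalg_eps comp_idl (tenm_id HM) comp_idr.
Qed.

(** From here on the derived maps are composites of lifted ones, so the proofs follow their
    definitions factor by factor. *)
Lemma unit_iso_map : coalg_map (A := S'ᴳ Iᴳ) (B := Sᴳ Iᴳ) (unit_iso X).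
Proof.
apply: (comp_map _ (luni_map HM Hφ (S'ᴳ Iᴳ))).
apply: (comp_map (sa_ev_map (S'ᴳ Iᴳ) Iᴳ)).
apply: (ten_map HM Hφ _ (id_map _)).
exact: (comp_map (con_map Hν (run_map HM Hφ (S'ᴳ Iᴳ))) (sa_kap_map Iᴳ)).
Qed.

Lemma unit_isoi_map : coalg_map (A := Sᴳ Iᴳ) (B := S'ᴳ Iᴳ) (unit_isoi X).
Proof.
apply: (comp_map _ (runi_map HM Hφ (Sᴳ Iᴳ))).
apply: (comp_map (sa_ev'_map Iᴳ (Sᴳ Iᴳ))).
apply: (ten_map HM Hφ (id_map _)).
exact: (comp_map (con_map Hν' (lun_map HM Hφ (Sᴳ Iᴳ))) (sa_eta_map Iᴳ)).
Qed.

Lemma SSI_of_I_map : coalg_map (A := Iᴳ) (B := Sᴳ Jᴳ) (SSI_of_I X).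
Proof. exact: (comp_map (con_map Hν unit_isoi_map) (sa_kap_map Iᴳ)). Qed.

Lemma par_asc_map (A B D : coalgebra G) :
  coalg_map (A := pten (pten A B) D) (B := pten A (pten B D)) (asc P A B D).
Proof.
exact: (comp_map
  (comp_map (con_map Hν' (ten_map HM Hφ (sa_kapi_map (sten (Sᴳ D) (Sᴳ B))) (id_map (Sᴳ A))))
            (con_map Hν' (asc_map HM Hφ (Sᴳ D) (Sᴳ B) (Sᴳ A))))
  (con_map Hν' (ten_map HM Hφ (id_map (Sᴳ D)) (sa_kap_map (sten (Sᴳ B) (Sᴳ A)))))).
Qed.

Lemma par_lun_map (A : coalgebra G) : coalg_map (A := pten Jᴳ A) (lun P A).
Proof.
exact: (comp_map (comp_map (sa_etai_map A) (con_map Hν' (runi_map HM Hφ (Sᴳ A))))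
  (con_map Hν' (ten_map HM Hφ (id_map (Sᴳ A)) SSI_of_I_map))).
Qed.

Lemma par_run_map (A : coalgebra G) : coalg_map (A := pten A Jᴳ) (run P A).
Proof.
exact: (comp_map (comp_map (sa_etai_map A) (con_map Hν' (luni_map HM Hφ (Sᴳ A))))
  (con_map Hν' (ten_map HM Hφ SSI_of_I_map (id_map (Sᴳ A))))).
Qed.

Lemma par_ev_r_map (A B : coalgebra G) :
  coalg_map (A := sten (pten A B) (S'ᴳ B)) (B := A) (par_ev_r X A B).
Proof.
exact: (comp_map (comp_map (sa_etai_map A) (sa_ev'_map (Sᴳ A) (pten A B)))
  (ten_map HM Hφ (id_map (pten A B))
    (con_map Hν' (comp_map (sa_etai_map B) (sa_ev'_map (Sᴳ B) (Sᴳ A)))))).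
Qed.

Lemma par_swap_map (A B : coalgebra G) :
  coalg_map (A := pten A B) (B := Sᴳ (sten (S'ᴳ B) (S'ᴳ A))) (par_swap X A B).
Proof.
exact: (comp_map (comp_map
  (con_map Hν (ten_map HM Hφ (id_map (S'ᴳ B)) (con_map Hν' (par_ev_r_map A B))))
  (con_map Hν (sa_ev'_map (pten A B) (S'ᴳ B)))) (sa_kap_map (pten A B))).
Qed.

Lemma par_ev_l_map (A B : coalgebra G) :
  coalg_map (A := sten (Sᴳ A) (Sᴳ (sten (S'ᴳ B) (S'ᴳ A)))) (B := B) (par_ev_l X A B).
Proof.
exact: (comp_map (comp_map (sa_kapi_map B) (sa_ev_map (Sᴳ (sten (S'ᴳ B) (S'ᴳ A))) (S'ᴳ B)))
  (ten_map HM Hφ (con_map Hν (comp_map (sa_kapi_map A) (sa_ev_map (S'ᴳ B) (S'ᴳ A))))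
    (id_map (Sᴳ (sten (S'ᴳ B) (S'ᴳ A)))))).
Qed.

Lemma par_swapi_map (A B : coalgebra G) :
  coalg_map (A := Sᴳ (sten (S'ᴳ B) (S'ᴳ A))) (B := pten A B) (par_swapi X A B).
Proof.
set Z := Sᴳ (sten (S'ᴳ B) (S'ᴳ A)).
exact: (comp_map
  (con_map Hν' (comp_map (sa_ev_map (Sᴳ A) Z)
    (ten_map HM Hφ (con_map Hν (par_ev_l_map A B)) (id_map (Sᴳ A)))))
  (sa_eta_map Z)).
Qed.

Lemma distl_of_sa_map (A B D : coalgebra G) :
  coalg_map (A := sten A (pten B D)) (B := pten (sten A B) D) (distl_of_sa X A B D).
Proof.
exact: (comp_map (sa_ev'_map (sten (Sᴳ D) (Sᴳ (sten A B))) A)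
  (ten_map HM Hφ (id_map A)
    (comp_map (con_map Hν' (asc_map HM Hφ (Sᴳ D) (Sᴳ (sten A B)) A))
      (con_map Hν' (ten_map HM Hφ (id_map (Sᴳ D)) (sa_ev_map A B)))))).
Qed.

Lemma distr_of_sa_map (A B D : coalgebra G) :
  coalg_map (A := sten (pten B D) A) (B := pten B (sten D A)) (distr_of_sa X B D A).
Proof.
exact: (comp_map (comp_map (comp_map (par_swapi_map B (sten D A))
    (sa_ev_map A (sten (S'ᴳ (sten D A)) (S'ᴳ B))))
  (ten_map HM Hφ (comp_map (con_map Hν (asci_map HM Hφ A (S'ᴳ (sten D A)) (S'ᴳ B)))
    (con_map Hν (ten_map HM Hφ (sa_ev'_map D A) (id_map (S'ᴳ B))))) (id_map A)))
  (ten_map HM Hφ (par_swap_map B D) (id_map A))).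
Qed.

Lemma ev_unit_map (A : coalgebra G) : coalg_map (A := sten (Sᴳ A) A) (B := Jᴳ) (ev_unit X A).
Proof.
exact: (comp_map (sa_ev_map A Iᴳ)
  (ten_map HM Hφ (con_map Hν (run_map HM Hφ A)) (id_map A))).
Qed.

Lemma ev'_unit_map (A : coalgebra G) :
  coalg_map (A := sten A (S'ᴳ A)) (B := S'ᴳ Iᴳ) (ev'_unit X A).
Proof.
exact: (comp_map (sa_ev'_map Iᴳ A)
  (ten_map HM Hφ (id_map A) (con_map Hν' (lun_map HM Hφ A)))).
Qed.

Lemma n_of_sa_map (A : coalgebra G) :
  coalg_map (A := Iᴳ) (B := pten A (Sᴳ A)) (ldn_n (ldn_of_sa X) A).
Proof.
exact: (comp_map (comp_map (comp_map (par_swapi_map A (Sᴳ A))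
    (con_map Hν (ten_map HM Hφ (sa_etai_map A) (id_map (S'ᴳ A)))))
  (con_map Hν (ev'_unit_map A))) (sa_kap_map Iᴳ)).
Qed.

Lemma n'_of_sa_map (A : coalgebra G) :
  coalg_map (A := Iᴳ) (B := pten (S'ᴳ A) A) (ldn_n' (ldn_of_sa X) A).
Proof.
exact: (comp_map (comp_map
    (con_map Hν' (ten_map HM Hφ (id_map (Sᴳ A)) (sa_kapi_map A)))
  (con_map Hν' (ev_unit_map A))) (sa_eta_map Iᴳ)).
Qed.

Lemma e'_of_sa_map (A : coalgebra G) :
  coalg_map (A := sten A (S'ᴳ A)) (B := Jᴳ) (ldn_e' (ldn_of_sa X) A).
Proof. exact: comp_map unit_iso_map (ev'_unit_map A). Qed.

(** The first component is the structure map of [pten] at cofree coalgebras followed by counits,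
    with the counits already cancelled, as [par_cofree] confirms. The second is the structure map of
    [Jᴳ]. *)
Definition par_lax : lax_ops G P := LaxOps (M := P)
  (fun A B => fmap G (cmap S' (φ (S (G B)) (S (G A)) ∘ (ν B ⋆₁ ν A))) ∘ ν' (S (G B) ⋆ S (G A)))
  (fmap G (cmap S (lax0 φ)) ∘ ν I).
Local Notation ψ := par_lax.

Lemma par_lax_nat (A A' B B' : C) (f : A ~> A') (g : B ~> B') :
  ψ A' B' ∘ (fmap G f ◇₁ fmap G g) = fmap G (f ◇₁ g) ∘ ψ A B.
Proof.
rewrite /= (comp_pre (lifting_nat Hν' _)) !comp_assoc -!fmap_cmap; congr (fmap G (cmap S' _) ∘ _).
rewrite comp_assoc -(lax2_nat Hφ) !(tenm_merge_pre HM) !(lifting_nat Hν).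
by [].
Qed.

Lemma par_str_post (A B : coalgebra G) (A' B' : C) (f : A ~> A') (g : B ~> B') :
  fmap G (f ◇₁ g) ∘ coalg_str (pten A B)
  = ψ A' B' ∘ ((fmap G f ∘ coalg_str A) ◇₁ (fmap G g ∘ coalg_str B)).
Proof.
(* By naturality of [ν'], the structure of [pten A B] is the tensor coalgebra structure that [ψ]
   determines. *)
have -> : coalg_str (pten A B) = ψ A B ∘ (coalg_str A ◇₁ coalg_str B).
  rewrite /= (comp_pre (lifting_nat Hν' _)) comp_assoc -fmap_cmap comp_assoc -(lax2_nat Hφ).
  by rewrite (tenm_merge_pre HM).
by rewrite comp_assoc -par_lax_nat -comp_assoc par_comp.
Qed.

Lemma par_cofree (A B : C) :
  fmap G (eps G A ◇₁ eps G B) ∘ coalg_str (pten (cofree G A) (cofree G B)) = ψ A B.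
Proof. by rewrite par_str_post !delta_epsr par_id comp_idr. Qed.

(** The constraint laws come from [asc], [lun] and [run] being coalgebra maps at cofree coalgebras,
    and the compatibilities with [delta] and [eps] from the coalgebra laws of [pten] and [Jᴳ]. *)
Lemma par_lax_monoidal : monoidal_comonad ψ.
Proof.
split.
- exact: par_lax_nat.
- move=> A B D.
  have := f_equal (comp (fmap G (eps G A ◇₁ (eps G B ◇₁ eps G D))))
    (par_asc_map (cofree G A) (cofree G B) (cofree G D)).
  rewrite (comp_assoc _ _ (asc P _ _ _)).
  rewrite (par_str_post (A := cofree G A) (B := pten (cofree G B) (cofree G D))) par_cofree delta_epsr => <-.
  rewrite [RHS]comp_assoc -[in RHS]fmap_comp -[in RHS]par_asc_nat [in RHS]fmap_comp -[RHS]comp_assoc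
    (par_str_post (A := pten (cofree G A) (cofree G B)) (B := cofree G D)) par_cofree.
  by rewrite delta_epsr -[LHS]comp_assoc.
- move=> A.
  have := f_equal (comp (fmap G (eps G A))) (par_lun_map (cofree G A)).
  rewrite (comp_assoc _ _ (lun P _)) delta_epsr comp_idl => <-.
  rewrite [RHS]comp_assoc -[in RHS]fmap_comp -[in RHS]par_lun_nat [in RHS]fmap_comp -[RHS]comp_assoc
    (par_str_post (A := Jᴳ) (B := cofree G A)).
  by rewrite delta_epsr fmap_id comp_idl -[LHS]comp_assoc.
- move=> A.
  have := f_equal (comp (fmap G (eps G A))) (par_run_map (cofree G A)).
  rewrite (comp_assoc _ _ (run P _)) delta_epsr comp_idl => <-.
  rewrite [RHS]comp_assoc -[in RHS]fmap_comp -[in RHS]par_run_nat [in RHS]fmap_comp -[RHS]comp_assoc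
    (par_str_post (A := cofree G A) (B := Jᴳ)).
  by rewrite delta_epsr fmap_id comp_idl -[LHS]comp_assoc.
- move=> A B.
  rewrite -{1}par_cofree comp_assoc delta_nat -[LHS]comp_assoc.
  rewrite (coalg_delta (pten (cofree G A) (cofree G B))) comp_assoc -fmap_comp par_cofree.
  rewrite -[RHS]comp_assoc; congr (_ ∘ _).
  have := par_str_post (A := cofree G A) (B := cofree G B) (idm _) (idm _).
  by rewrite par_id !fmap_id !comp_idl.
- exact: (coalg_delta Jᴳ).
- move=> A B.
  by rewrite -par_cofree comp_assoc eps_nat -[LHS]comp_assoc (coalg_eps (pten (cofree G A) (cofree G B))) comp_idr.
- exact: (coalg_eps Jᴳ).
Qed.

Theorem ldn_comonad_of_sa : ldn_comonad (L := ldn_of_sa X) φ ψ ν ν'.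
Proof.
split=> //.
- exact: par_lax_monoidal.
- move=> A B D.
  (* Counits on the target collapse its structure map to [ψ] and [φ]; slid through the distribution
     by naturality, they do the same on the source. *)
  have := f_equal (comp (fmap G ((eps G A ⋆₁ eps G B) ◇₁ eps G D)))
    (distl_of_sa_map (cofree G A) (cofree G B) (cofree G D)).
  rewrite (comp_assoc _ _ (distl_of_sa X _ _ _))
    (par_str_post (A := sten (cofree G A) (cofree G B)) (B := cofree G D))
    (ten_str_post HM Hφ (A := cofree G A) (B := cofree G B)) !delta_epsr.
  rewrite (tenm_id HM) comp_idr => <-.
  rewrite [RHS]comp_assoc -[in RHS]fmap_comp -[in RHS]distl_of_sa_nat [in RHS]fmap_comp -[RHS]comp_assoc
    (ten_str_post HM Hφ (A := cofree G A) (B := pten (cofree G B) (cofree G D))) par_cofree.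
  by rewrite delta_epsr -[LHS]comp_assoc.
- move=> A B D.
  have := f_equal (comp (fmap G (eps G B ◇₁ (eps G D ⋆₁ eps G A))))
    (distr_of_sa_map (cofree G A) (cofree G B) (cofree G D)).
  rewrite (comp_assoc _ _ (distr_of_sa X _ _ _))
    (par_str_post (A := cofree G B) (B := sten (cofree G D) (cofree G A)))
    (ten_str_post HM Hφ (A := cofree G D) (B := cofree G A)) !delta_epsr.
  rewrite (tenm_id HM) comp_idr => <-.
  rewrite [RHS]comp_assoc -[in RHS]fmap_comp -[in RHS]distr_of_sa_nat [in RHS]fmap_comp -[RHS]comp_assoc
    (ten_str_post HM Hφ (A := pten (cofree G B) (cofree G D)) (B := cofree G A)) par_cofree.
  by rewrite delta_epsr -[LHS]comp_assoc.
- move=> A.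
  (* Precomposition is used here: [con_cofree] recovers [ν A] on one side, and dinaturality moves
     the counit to the factor [G A] on the other. *)
  have := f_equal (fun k => k ∘ (cmap S (eps G A) ⋆₁ idm (G A))) (ev_unit_map (cofree G A)).
  rewrite -[LHS]comp_assoc -[RHS]comp_assoc /= ev_unit_dinat.
  have := con_cofree Hν A; rewrite /= => E.
  rewrite -[in X in X -> _]comp_assoc (tenm_merge HM) E comp_idr => H.
  by rewrite -[LHS]comp_assoc -[RHS]comp_assoc.
- move=> A.
  (* The counit is applied to the first factor only; dinaturality of [n] converts it into
     [cmap S (eps G A)] on the second, as the condition asks. *)
  have := f_equal (comp (fmap G (eps G A ◇₁ idm _))) (n_of_sa_map (cofree G A)).
  rewrite [LHS]comp_assoc -[in LHS]fmap_comp n_of_sa_dinat [RHS]comp_assoc.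
  rewrite (par_str_post (A := cofree G A) (B := Sᴳ (cofree G A))) delta_epsr fmap_id comp_idl.
  (* The structure of [S] at the cofree coalgebra is [fmap G (cmap S (delta G A)) ∘ ν (G A)], and
     naturality of [ψ] takes its first factor outside. *)
  have -> : ψ A (S (G A)) ∘ (idm (G A) ◇₁ coalg_str (Sᴳ (cofree G A)))
      = fmap G (idm A ◇₁ cmap S (delta G A)) ∘ ψ A (S (G (G A))) ∘ (idm (G A) ◇₁ ν (G A)).
    by rewrite -par_lax_nat -[RHS]comp_assoc -par_comp fmap_id comp_idl.
  by rewrite fmap_comp.
- move=> A.
  have := f_equal (fun k => k ∘ (idm (G A) ⋆₁ cmap S' (eps G A))) (e'_of_sa_map (cofree G A)).
  rewrite -[LHS]comp_assoc -[RHS]comp_assoc e'_of_sa_dinat /= => H.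
  have := con_cofree Hν' A; rewrite /= => E.
  move: H; rewrite -[in X in X -> _]comp_assoc (tenm_merge HM) E comp_idr => H.
  by rewrite -[LHS]comp_assoc -[RHS]comp_assoc.
- move=> A.
  have := f_equal (comp (fmap G (idm _ ◇₁ eps G A))) (n'_of_sa_map (cofree G A)).
  rewrite [LHS]comp_assoc -[in LHS]fmap_comp n'_of_sa_dinat [RHS]comp_assoc.
  rewrite (par_str_post (A := S'ᴳ (cofree G A)) (B := cofree G A)) delta_epsr fmap_id comp_idl.
  have -> : ψ (S' (G A)) A ∘ (coalg_str (S'ᴳ (cofree G A)) ◇₁ idm (G A))
      = fmap G (cmap S' (delta G A) ◇₁ idm A) ∘ ψ (S' (G (G A))) A ∘ (ν' (G A) ◇₁ idm (G A)).
    by rewrite -par_lax_nat -[RHS]comp_assoc -par_comp fmap_id comp_idl.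
  by rewrite fmap_comp.
Qed.

End Lift.
End Sa.

Theorem mainTheorem3 :
  (forall (C : category) (L : ldn_ops C) (G : comonad C)
     (phi : lax_ops G (star L)) (psi : lax_ops G (par L))
     (nu : forall A : C, ldn_S L A ~> G (ldn_S L (G A)))
     (nu' : forall A : C, ldn_S' L A ~> G (ldn_S' L (G A))),
     is_ldn L ->
     ldn_comonad phi psi nu nu' ->
     sa_comonad (X := sa_of_ldn L) phi nu nu')
  /\
  (forall (C : category) (X : sa_ops C) (G : comonad C)
     (phi : lax_ops G (sa_ten X))
     (nu : forall A : C, sa_S X A ~> G (sa_S X (G A)))
     (nu' : forall A : C, sa_S' X A ~> G (sa_S' X (G A))),
     is_star_autonomous X ->
     sa_comonad phi nu nu' ->
     exists psi : lax_ops G (par (ldn_of_sa X)),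
       ldn_comonad (L := ldn_of_sa X) phi psi nu nu').
Proof.
split=> [C L G φ ψ ν ν' HL HG | C X G φ ν ν' HX HG].
- exact: (sa_comonad_of_ldn HL HG).
- by exists (par_lax φ ν ν'); apply: ldn_comonad_of_sa.
Qed.
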